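(* Let $d\ge1$. There is a constant $c>0$ depending only on $d$ such that for every $N\ge1$ and every set $Z=\{z_1,\dots,z_N\}\subset\mathbb{S}^d$, $$D_{L^2,\mathrm{cap}}(Z)\;\ge\; c\,N^{-\frac12-\frac1{2d}}\left(\frac1N\sum_{i,j=1}^{N}\frac{\log\bigl(2+N^{1/d}\|z_i-z_j\|\bigr)}{\bigl(1+N^{1/d}\|z_i-z_j\|\bigr)^{d+1}}\right)^{1/2}.$$
   Context: $\mathbb{S}^d$ is the unit sphere in $\mathbb{R}^{d+1}$ with normalized surface measure $\sigma$; $\|\cdot\|$ is the Euclidean norm. For $x\in\mathbb{S}^d$ and $\tau\in[-1,1]$, $C(x,\tau)=\{y\in\mathbb{S}^d: x\cdot y\ge\tau\}$ is a spherical cap. The $L^2$-spherical cap discrepancy of $Z$ is defined by $$D_{L^2,\mathrm{cap}}^2(Z)=\int_{-1}^{1}\int_{\mathbb{S}^d}\Bigl|\frac1N\sum_{j=1}^N\mathbf{1}_{C(x,\tau)}(z_j)-\sigma\bigl(C(x,\tau)\bigr)\Bigr|^2\,d\sigma(x)\,d\tau .$$ *)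

(* Defs.v *)
From HB Require Import structures.
From mathcomp Require Import all_boot all_order all_algebra.
From mathcomp Require Import all_classical all_reals all_analysis.
Set Implicit Arguments. Unset Strict Implicit. Unset Printing Implicit Defensive.
Import Order.TTheory GRing.Theory Num.Theory.
Import numFieldNormedType.Exports.
Local Open Scope classical_set_scope.
Local Open Scope ring_scope.

Section Defs.
Variable R : realType.

(* Iterated Lebesgue integral over the first n coordinates of x : nat -> R.
   For nonnegative Borel integrands this is the Lebesgue integral on R^n (Tonelli). *)
Fixpoint iint (n : nat) (f : (nat -> R) -> \bar R) : \bar R :=
  match n with
  | 0 => f (fun _ => 0)
  | m.+1 => (\int[@lebesgue_measure R]_t
               iint m (fun x => f (fun i => if i == m then t else x i)))%E
  end.

Definition lebRn (n : nat) (f : 'rV[R]_n -> \bar R) : \bar R :=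
  iint n (fun x => f (\row_(i < n) x i)).

Definition dotv (n : nat) (x y : 'rV[R]_n) : R := \sum_(i < n) x ord0 i * y ord0 i.
Definition eucl (n : nat) (x : 'rV[R]_n) : R := Num.sqrt (dotv x x).

Definition on_sphere (n : nat) (x : 'rV[R]_n) : Prop := eucl x = 1.

(* integral against the normalized surface measure sigma on the unit sphere of R^n,
   defined as the (normalized) cone measure:
   int_{S} g dsigma = (1/|B|) int_B g (y/|y|) dy, B the unit ball. *)
Definition ball_vol (n : nat) : \bar R := lebRn (fun y : 'rV[R]_n => ((eucl y <= 1)%R%:R)%:E).
Definition sphere_int (n : nat) (g : 'rV[R]_n -> \bar R) : \bar R :=
  (lebRn (fun y : 'rV[R]_n => ((eucl y <= 1)%R%:R)%:E * g ((eucl y)^-1 *: y))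
     / ball_vol n)%E.

Definition cap (n : nat) (x : 'rV[R]_n) (tau : R) : set 'rV[R]_n :=
  [set y | on_sphere y /\ tau <= dotv x y].
Definition cap_measure (n : nat) (x : 'rV[R]_n) (tau : R) : R :=
  fine (sphere_int (fun y => ((tau <= dotv x y)%R%:R)%:E)).

Definition cap_disc2 (d N : nat) (z : 'I_N -> 'rV[R]_d.+1) : \bar R :=
  (\int[@lebesgue_measure R]_(tau in `[(-1)%R, 1%R])
     sphere_int (fun x : 'rV[R]_d.+1 =>
       (((N%:R)^-1 * \sum_(j < N) (\1_(cap x tau) (z j) : R)
          - cap_measure x tau) ^+ 2)%:E))%E.

Definition cap_disc (d N : nat) (z : 'I_N -> 'rV[R]_d.+1) : R :=
  Num.sqrt (fine (cap_disc2 z)).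

End Defs.

(* Main.v *)
(* For a direction x write F_x, G_x for the distribution functions of x . y under the empirical
   measure P of Z and under the surface measure S. The squared discrepancy is the average over x of
   the integral of (F_x - G_x)^2, and for each x this integral is the energy
     E|x.Y - x.Y'| - E|x.Y - x.Y1|/2 - E|x.Y' - x.Y1'|/2   (Y, Y1 ~ P and Y', Y1' ~ S independent).
   Everything being homogeneous in x, the sphere may be replaced by a Gaussian vector x, for which
   |x . w| averages to c|w|. Writing c|w| as the integral of (1 - exp(-t^4 |w|^2)) |t|^-3 dt turns
   the discrepancy into the integral of |t|^-3 e(t), where
     e(t) = g(P, P) + g(S, S) - 2 g(P, S) >= 0
   is the energy of P - S for the Gaussian kernel exp(-t^4 |w|^2). Keep only |t| <= l, with |t|^-3
   lowered to (t/l)^(2d) l^-3. Positive definiteness gives e >= g(P, P)/2 - g(S, S), and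
   g(S, S) = O(t^(-2d)), so that the surface measure contributes O(l^(-2d - 2)), while P contributes
   c l^-2 times the mean of (1 + l^2 |z_i - z_j|)^(-d - 1/2). For l^2 = A N^(1/d) with A large, the
   diagonal terms i = j alone dominate the contribution of S, and the kernel dominates
   log(2 + N^(1/d) r) / (1 + N^(1/d) r)^(d + 1). *)
Require Import Defs.
From HB Require Import structures.
From mathcomp Require Import all_boot all_order all_algebra.
From mathcomp Require Import all_classical all_reals all_analysis.
From mathcomp Require Import measurable_realfun ring lra.
Set Implicit Arguments. Unset Strict Implicit. Unset Printing Implicit Defensive.
Import Order.TTheory GRing.Theory Num.Theory.
Import numFieldNormedType.Exports.
Local Open Scope classical_set_scope.
Local Open Scope ring_scope.

(** Only a lower bound is wanted, so passing from the sphere to the ball and from the ball to the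
    Gaussian costs one-sided inequalities; the exact step is the identity between the Gaussian
    average of the discrepancy and the integral of |t|^-3 e(t). The obstacle there is that energies
    occur with opposite signs, whereas integrals are interchanged for nonnegative functions with
    values in the extended reals. Each identity is therefore stated with positive terms on both
    sides, and solved for the discrepancy only once the three distance energies are known to be
    finite.

    The size of l is dictated by scaling. With m = N^(1/d), the diagonal contributes a multiple of
    l^-2 N^-1 and the surface measure a multiple of l^-2 l^(-2d). For l^2 = A m both are of order (N
    m)^-1, the second with an additional factor A^-d, which a large A makes harmless. The square
    root of (N m)^-1 is the power of N in the statement. The kernel beats the logarithm because
    log(2 + r) <= 2 (1 + r)^(1/2), exactly the half power by which the exponents differ. *)

(** * Nonnegative integrals: pushforward, linearity, Tonelli *)

Definition push_measure d d' (T1 : measurableType d) (T2 : measurableType d')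
    (R : realType) (m : {measure set T1 -> \bar R}) (f : T1 -> T2)
    (mf : measurable_fun setT f) : {measure set T2 -> \bar R} :=
  measure_function_pushforward__canonical__measure_function_Measure m mf.

Lemma ge0_integral_push d d' (T1 : measurableType d) (T2 : measurableType d')
    (R : realType) (m : {measure set T1 -> \bar R}) (phi : T1 -> T2)
    (mphi : measurable_fun setT phi) (f : T2 -> \bar R) :
  measurable_fun setT f -> (forall x, 0 <= f x)%E ->
  (\int[push_measure m mphi]_x f x = \int[m]_x f (phi x))%E.
Proof. by move=> mf f0; rewrite (ge0_integral_pushforward mphi). Qed.

Section integral_setT.
Context d d' (T1 : measurableType d) (T2 : measurableType d') (R : realType).
Local Open Scope ereal_scope.

Lemma integralTZl (m : {measure set T1 -> \bar R}) (k : R) (f : T1 -> \bar R) :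
  (0 <= k)%R -> measurable_fun setT f -> (forall x, 0 <= f x) ->
  \int[m]_x (k%:E * f x) = k%:E * \int[m]_x f x.
Proof. by move=> k0 mf f0; rewrite ge0_integralZl_EFin. Qed.

Lemma integralTZr (m : {measure set T1 -> \bar R}) (k : \bar R) (f : T1 -> \bar R) :
  0 <= k -> measurable_fun setT f -> (forall x, 0 <= f x) ->
  \int[m]_x (f x * k) = (\int[m]_x f x) * k.
Proof. by move=> k0 mf f0; apply: ge0_integralZr. Qed.

Lemma integralTD (m : {measure set T1 -> \bar R}) (f g : T1 -> \bar R) :
  measurable_fun setT f -> (forall x, 0 <= f x) ->
  measurable_fun setT g -> (forall x, 0 <= g x) ->
  \int[m]_x (f x + g x) = \int[m]_x f x + \int[m]_x g x.
Proof. by move=> mf f0 mg g0; apply: ge0_integralD. Qed.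

Lemma le_integralT (m : {measure set T1 -> \bar R}) (f g : T1 -> \bar R) :
  measurable_fun setT f -> (forall x, 0 <= f x) -> measurable_fun setT g ->
  (forall x, f x <= g x) -> \int[m]_x f x <= \int[m]_x g x.
Proof. by move=> mf f0 mg fg; apply: ge0_le_integral. Qed.

Variables (m1 : {sigma_finite_measure set T1 -> \bar R}).
Variables (m2 : {sigma_finite_measure set T2 -> \bar R}).

Lemma measurable_integral_param (f : T1 -> T2 -> \bar R) :
  measurable_fun setT (fun p => f p.1 p.2) -> (forall x y, 0 <= f x y) ->
  measurable_fun setT (fun x => \int[m2]_y f x y).
Proof.
move=> mf f0.
exact: (measurable_fun_fubini_tonelli_F _ mf (fun p => f0 p.1 p.2)).
Qed.

Lemma integral_prodE (f : T1 -> T2 -> \bar R) :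
  measurable_fun setT (fun p => f p.1 p.2) -> (forall x y, 0 <= f x y) ->
  \int[m1 \x m2]_p f p.1 p.2 = \int[m1]_x \int[m2]_y f x y.
Proof. by move=> mf f0; exact: (fubini_tonelli1 _ mf (fun p => f0 p.1 p.2)). Qed.

Lemma integral_swap (f : T1 -> T2 -> \bar R) :
  measurable_fun setT (fun p => f p.1 p.2) -> (forall x y, 0 <= f x y) ->
  \int[m1]_x \int[m2]_y f x y = \int[m2]_y \int[m1]_x f x y.
Proof. by move=> mf f0; exact: (fubini_tonelli _ mf (fun p => f0 p.1 p.2)). Qed.

End integral_setT.

Section sigma_finite_pack.
Context d (T : measurableType d) (R : realType).
Variables (m : {measure set T -> \bar R}) (sf : sigma_finite setT m).
Let m' : set T -> \bar R := m.
HB.instance Definition _ := Measure.on m'.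
HB.instance Definition _ := Measure_isSigmaFinite.Build _ _ _ m' sf.
(** Bundles a measure with a separately proved sigma-finiteness, so that a measure built inside an
    induction can enter the next product. *)
Definition sigma_finite_pack : {sigma_finite_measure set T -> \bar R} := m'.
End sigma_finite_pack.

(** * Affine substitutions on the line *)

Section affine_change_of_variable.
Context {R : realType}.
Local Notation leb := (@lebesgue_measure R).
Local Open Scope ereal_scope.

Lemma measurable_affine (a b : R) : measurable_fun setT (fun t : R => a * t + b)%R.
Proof. by apply: measurable_funD => //; apply: measurable_funM. Qed.

(** The pushforward under the affine map, multiplied by [a], gives half-open intervals their length,
    hence is Lebesgue measure by uniqueness. *)
Lemma ge0_integral_affine_pos (a b : R) (f : R -> \bar R) : (0 < a)%R ->
  measurable_fun setT f -> (forall x, 0 <= f x) ->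
  \int[leb]_t f (a * t + b)%R = (a^-1)%:E * \int[leb]_t f t.
Proof.
move=> a0 mf f0.
have mp := measurable_affine a b.
have a0' : (0 <= a)%R by exact: ltW.
pose h (t : measurableTypeR R) : measurableTypeR R := (a * t + b)%R.
have mh : measurable_fun setT h by exact: mp.
pose m2 : {measure set (measurableTypeR R) -> \bar R} := mscale (NngNum a0') (push_measure leb mh).
have E X : measurable X -> leb X = m2 X.
  apply: lebesgue_measure_unique => //= _ [[x y]] _ <-.
  rewrite /m2 /mscale /= /mscale /= /pushforward /h.
  rewrite (_ : _ @^-1` _ = [set` `](x - b) / a, (y - b) / a]%R]); last first.
    apply/seteqP; split=> t /=; rewrite !in_itv/= ltr_pdivrMr// ler_pdivlMr//;
    by rewrite ltrBlDr lerBrDr mulrC.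
  rewrite !lebesgue_measure_itv/= !lte_fin ltr_pM2r ?invr_gt0// ltrD2r.
  case: ifPn => _; last by rewrite mule0.
  rewrite -!EFinD -EFinM; congr EFin.
  by field; rewrite gt_eqF.
have -> : \int[leb]_t f t = \int[m2]_t f t.
  by apply: eq_measure_integral => A mA _; exact: E.
rewrite ge0_integral_mscale//=.
rewrite (ge0_integral_pushforward mh)//=.
rewrite muleA -EFinM mulVf ?gt_eqF// mul1e.
by apply: eq_integral.
Qed.

Lemma ge0_integral_opp (f : R -> \bar R) :
  measurable_fun setT f -> (forall x, 0 <= f x) ->
  \int[leb]_t f (- t)%R = \int[leb]_t f t.
Proof.
move=> mf f0.
pose h (t : measurableTypeR R) : measurableTypeR R := (- t)%R.
have mh : measurable_fun setT h by exact: oppr_measurable.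
have -> : \int[leb]_t f t = \int[push_measure leb mh]_t f t.
  by apply: eq_measure_integral => A mA _; rewrite /= lebesgue_measureN.
by rewrite (ge0_integral_pushforward mh).
Qed.

Lemma ge0_integral_affine (a b : R) (f : R -> \bar R) : (a != 0)%R ->
  measurable_fun setT f -> (forall x, 0 <= f x) ->
  \int[leb]_t f (a * t + b)%R = (`|a|^-1)%:E * \int[leb]_t f t.
Proof.
move=> a0 mf f0; case: (ltgtP a 0%R) a0 => // [an|ap] _; last first.
  by rewrite ger0_norm ?(ltW ap)// ge0_integral_affine_pos.
rewrite ltr0_norm// -(ge0_integral_affine_pos b) ?oppr_gt0//.
rewrite -[RHS]ge0_integral_opp//; last first.
  by apply: measurableT_comp => //; exact: measurable_affine.
by apply: eq_integral => t _; rewrite mulrNN.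
Qed.

End affine_change_of_variable.

(** * The iterated integral as a measure on tuples *)

Section lebesgue_on_tuples.
Context {R : realType}.
Local Notation leb := (@lebesgue_measure R).
Local Open Scope ereal_scope.

(** The new coordinate is put last because [iint m.+1] has coordinate [m] as its outermost
    variable. *)
Definition snoc m (p : R * m.-tuple R) : m.+1.-tuple R := [tuple of rcons p.2 p.1].

Lemma tnth_snoc m (p : R * m.-tuple R) (i : 'I_m.+1) :
  tnth (snoc p) i = if insub (i : nat) is Some j then tnth p.2 j else p.1.
Proof.
rewrite (tnth_nth 0%R) /= nth_rcons size_tuple.
case: insubP => [j im ji|]; first by rewrite -ji ltn_ord (tnth_nth 0%R).
rewrite -leqNgt => mi; rewrite ltnNge mi /=.
by rewrite eqn_leq mi -ltnS ltn_ord.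
Qed.

Lemma measurable_snoc m : measurable_fun setT (@snoc m).
Proof.
apply/measurable_fun_tnthP => i.
rewrite [X in measurable_fun _ X](_ : _ = fun p : R * m.-tuple R =>
   if insub (i : nat) is Some j then tnth p.2 j else p.1); last first.
  by apply/funext => p /=; rewrite tnth_snoc.
case: insubP => [j _ _|_]; last exact: measurable_fst.
by apply: (measurableT_comp (measurable_tnth j)); exact: measurable_snd.
Qed.

Definition cube n (k : nat) : set (n.-tuple R) :=
  [set x | forall i, (`|tnth x i| <= k%:R)%R].
Arguments cube : clear implicits.

Lemma measurable_cube n k : measurable (cube n k).
Proof.
rewrite (_ : cube n k = \bigcap_(i in [set: 'I_n]) [set x | (`|tnth x i| <= k%:R)%R]); last first.
  by apply/seteqP; split => x /= H i //=; exact: H.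
apply: fin_bigcap_measurable => // i _.
rewrite -[X in measurable X]setTI.
rewrite (_ : [set x | _] = (fun x : n.-tuple R => `|tnth x i| <= k%:R)%R @^-1` [set true]) //.
by apply: measurable_fun_ler => //; apply: measurableT_comp => //; exact: measurable_tnth.
Qed.

Lemma bigcup_cube n : \bigcup_k cube n k = setT.
Proof.
apply/seteqP; split => // x _.
exists (\sum_(i < n) (Num.truncn `|tnth x i|).+1)%N => // i.
apply: (@le_trans _ _ ((Num.truncn `|tnth x i|).+1%:R)%R).
  by apply/ltW/truncnS_gt.
by rewrite ler_nat (bigD1 i)//= leq_addr.
Qed.

Lemma preimage_snoc_cube m k :
  @snoc m @^-1` cube m.+1 k = [set` `[- k%:R, k%:R]%R] `*` cube m k.
Proof.
apply/seteqP; split=> -[t x] /=.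
  move=> H; split; first by have := H ord_max; rewrite tnth_snoc insubF ?ltnn//= in_itv/= ler_norml.
  move=> i; have := H (widen_ord (leqnSn m) i); rewrite tnth_snoc /=.
  by case: insubP => [j _ /= ji|]; [rewrite (_ : j = i)//; exact: val_inj| rewrite ltn_ord].
rewrite in_itv/= -ler_norml => -[tk xk] i; rewrite tnth_snoc.
by case: insubP => [j _ _|_] //=.
Qed.

(** Tonelli needs an actual measure behind [iint]. It is built by pushing the product of the line
    with the previous measure along [snoc]. Finiteness on cubes belongs to the induction, since it
    gives the sigma-finiteness required by the next product. *)
Lemma lebesgue_tuple_ex n : exists nu : {sigma_finite_measure set (n.-tuple R) -> \bar R},
  (forall k, nu (cube n k) < +oo) /\
  forall f : (nat -> R) -> \bar R, (forall x, 0 <= f x) ->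
    measurable_fun setT (fun x : n.-tuple R => f (nth 0%R x)) ->
    iint n f = \int[nu]_x f (nth 0%R x).
Proof.
elim: n => [|m [nu [nuc IH]]].
  exists (dirac ([tuple] : 0.-tuple R)); split.
    by move=> k; apply: (le_lt_trans (probability_le1 _ _)); [exact: measurable_cube|rewrite ltry].
  move=> f f0 mf /=; rewrite integral_dirac// diracT mul1e.
  by congr f; apply/funext => i; rewrite nth_nil.
pose push : {measure set (m.+1.-tuple R) -> \bar R} :=
  push_measure (leb \x nu)%E (@measurable_snoc m).
have pc k : push (cube m.+1 k) < +oo.
  rewrite /push /= /pushforward preimage_snoc_cube product_measure1E//; last exact: measurable_cube.
  have hk : leb [set` `[- k%:R, k%:R]%R] \is a fin_num.
    by rewrite lebesgue_measure_itv/=; case: ifPn.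
  exact: lte_mul_pinfty (measure_ge0 _ _) hk (nuc k).
have sf : sigma_finite setT push.
  exists (cube m.+1) => [|k]; first by rewrite bigcup_cube.
  by split; [exact: measurable_cube|exact: pc].
pose nu' : {sigma_finite_measure set (m.+1.-tuple R) -> \bar R} :=
  sigma_finite_pack sf.
exists nu'; split => // f f0 mf.
have mfs : measurable_fun setT (fun p : R * m.-tuple R => f (nth 0%R (snoc p))).
  exact: (measurableT_comp mf (@measurable_snoc m)).
transitivity (\int[(leb \x nu)%E]_p f (nth 0%R (snoc p))); last first.
  exact: esym (ge0_integral_push (leb \x nu)%E (@measurable_snoc m) mf (fun x => f0 _)).
transitivity (\int[leb]_t \int[nu]_x f (nth 0%R (snoc (t, x)))); last first.
  apply/esym; exact: (integral_prodE leb nu (f := fun t x => f (nth 0%R (snoc (t, x)))) mfs).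
apply: eq_integral => t _.
have E (x : m.-tuple R) : (fun i => if i == m then t else nth 0%R x i) = nth 0%R (snoc (t, x)).
  apply/funext => i; rewrite nth_rcons size_tuple.
  by case: (ltngtP i m) => // mi; rewrite nth_default// size_tuple ltnW.
rewrite [LHS](IH (fun x => f (fun i => if i == m then t else x i)))//.
  by apply: eq_integral => x _; rewrite E.
under eq_fun do rewrite E.
exact: (measurableT_comp mfs (pair1_measurable t)).
Qed.

Definition nu n : {sigma_finite_measure set (n.-tuple R) -> \bar R} :=
  projT1 (cid (lebesgue_tuple_ex n)).

Lemma iint_nu n (f : (nat -> R) -> \bar R) : (forall x, 0 <= f x) ->
  measurable_fun setT (fun x : n.-tuple R => f (nth 0%R x)) ->
  iint n f = \int[nu n]_x f (nth 0%R x).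
Proof. by rewrite /nu; case: cid => mu /= [_]; exact. Qed.

Definition tup n (x : nat -> R) : n.-tuple R := [tuple x i | i < n].

Lemma tup_nth n (x : n.-tuple R) : tup n (nth 0%R x) = x.
Proof. by apply: eq_from_tnth => i; rewrite tnth_mktuple -tnth_nth. Qed.

Lemma iint_tup n (f : n.-tuple R -> \bar R) : (forall x, 0 <= f x) ->
  measurable_fun setT f -> iint n (f \o tup n) = \int[nu n]_x f x.
Proof.
move=> f0 mf; rewrite iint_nu//=; first by under eq_integral do rewrite tup_nth.
by under eq_fun do rewrite tup_nth.
Qed.

Lemma nu0 (f : 0.-tuple R -> \bar R) : (forall x, 0 <= f x) ->
  measurable_fun setT f -> \int[nu 0]_x f x = f [tuple].
Proof.
by move=> f0 mf; rewrite -iint_tup//=; congr f; apply: eq_from_tnth => -[].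
Qed.

Lemma nuS n (f : n.+1.-tuple R -> \bar R) : (forall x, 0 <= f x) ->
  measurable_fun setT f ->
  \int[nu n.+1]_x f x = \int[leb]_t \int[nu n]_x f (snoc (t, x)).
Proof.
move=> f0 mf; rewrite -iint_tup//=; apply: eq_integral => t _.
rewrite -(iint_tup (f := fun x => f (snoc (t, x))))//; last first.
  apply: (measurableT_comp mf).
  exact: (measurableT_comp (@measurable_snoc n) (pair1_measurable t)).
congr iint; apply/funext => x /=; congr f; apply: eq_from_tnth => i.
rewrite tnth_mktuple tnth_snoc; case: insubP => [j jn ji|] /=.
  by rewrite tnth_mktuple ji ltn_eqF.
by rewrite -leqNgt => ni; rewrite eqn_leq ni -ltnS ltn_ord.
Qed.

End lebesgue_on_tuples.

(** * Automation for measurability and nonnegativity *)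

Ltac mstep := match goal with
 | |- measurable_fun _ (fun x => _) => first [exact: measurable_cst | exact: measurable_id
     | exact: measurable_fst | exact: measurable_snd | assumption]
 | |- measurable_fun _ (GRing.mul ?a) => exact: (measurable_funM (measurable_cst a) (@measurable_id _ _ _))
 | |- measurable_fun _ (GRing.add ?a) => exact: (measurable_funD (measurable_cst a) (@measurable_id _ _ _))
 | |- measurable_fun _ (fun x => EFin (@?f x)) => apply/measurable_EFinP
 | |- measurable_fun _ (fun x => GRing.add (@?f x) (GRing.opp (@?g x))) => apply: measurable_funB
 | |- measurable_fun _ (fun x => GRing.add (@?f x) (@?g x)) => apply: measurable_funD
 | |- measurable_fun _ (fun x => GRing.opp (@?f x)) => apply: measurable_funN
 | |- measurable_fun _ (fun x => GRing.mul (@?f x) (@?g x)) => apply: measurable_funM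
 | |- measurable_fun _ (fun x => GRing.exp (@?f x) _) => apply: measurable_funX
 | |- measurable_fun _ (fun x => expR (@?f x)) => apply: (measurableT_comp (@measurable_expR _))
 | |- measurable_fun _ (fun x => Num.norm (@?f x)) => apply: (measurableT_comp (@normr_measurable _ _))
 | |- measurable_fun _ (fun x => mule (@?f x) (@?g x)) => apply: emeasurable_funM
 | |- measurable_fun _ (fun x => fst (@?f x)) => apply: (measurableT_comp measurable_fst)
 | |- measurable_fun _ (fun x => snd (@?f x)) => apply: (measurableT_comp measurable_snd)
 | |- measurable_fun _ (fun x => pair (@?f x) (@?g x)) => apply: measurable_fun_pair
 | H : measurable_fun _ ?h |- measurable_fun _ ?h => exact: H
 | H : measurable_fun _ ?h |- measurable_fun _ (fun x => ?h (@?f x)) => apply: (measurableT_comp H)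
 end.
(** An extension point: [mext] is redefined once the operations on tuples are known to be
    measurable, and [mm] then covers them as well. *)
Ltac mext := fail.
Ltac mm := repeat (first [mstep | mext]); try exact: measurable_fst;
  try exact: measurable_snd; try exact: measurable_id.

Ltac pos := repeat (intros; first [done | apply: mule_ge0 | rewrite lee_fin | exact: expR_ge0
  | apply: sqrtr_ge0 | apply: integral_ge0 | rewrite invr_ge0 | apply: mulr_ge0 | apply: exprn_ge0]).

(** * Euclidean structure on tuples and Gaussian integrals *)

Section tuple_space.
Context {R : realType}.
Local Notation leb := (@lebesgue_measure R).

Definition tdot n (x y : n.-tuple R) : R := \sum_i tnth x i * tnth y i.
Definition nsq n (x : n.-tuple R) : R := tdot x x.
Definition scal n (s : R) (x : n.-tuple R) : n.-tuple R := [tuple s * tnth x i | i < n].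
Definition sub n (x y : n.-tuple R) : n.-tuple R := [tuple tnth x i - tnth y i | i < n].

Lemma measurable_tdot d (T : measurableType d) n (f g : T -> n.-tuple R) :
  measurable_fun setT f -> measurable_fun setT g ->
  measurable_fun setT (fun t => tdot (f t) (g t)).
Proof.
move=> mf mg; apply: measurable_sum => i.
by apply: measurable_funM; apply: (measurableT_comp (measurable_tnth i)).
Qed.

Lemma measurable_scal d (T : measurableType d) n (s : T -> R) (f : T -> n.-tuple R) :
  measurable_fun setT s -> measurable_fun setT f ->
  measurable_fun setT (fun t => scal (s t) (f t)).
Proof.
move=> ms mf; apply/measurable_fun_tnthP => i /=.
rewrite (_ : _ \o _ = fun t => s t * tnth (f t) i); last first.
  by apply/funext => t /=; rewrite tnth_mktuple.
by apply: measurable_funM => //; apply: (measurableT_comp (measurable_tnth i)).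
Qed.

Lemma measurable_sub d (T : measurableType d) n (f g : T -> n.-tuple R) :
  measurable_fun setT f -> measurable_fun setT g ->
  measurable_fun setT (fun t => sub (f t) (g t)).
Proof.
move=> mf mg; apply/measurable_fun_tnthP => i /=.
rewrite (_ : _ \o _ = fun t => tnth (f t) i - tnth (g t) i); last first.
  by apply/funext => t /=; rewrite tnth_mktuple.
by apply: measurable_funB; apply: (measurableT_comp (measurable_tnth i)).
Qed.

Lemma measurable_nsq d (T : measurableType d) n (f : T -> n.-tuple R) :
  measurable_fun setT f -> measurable_fun setT (fun t => nsq (f t)).
Proof. by move=> mf; exact: measurable_tdot. Qed.

Lemma nsq_ge0 n (x : n.-tuple R) : 0 <= nsq x.
Proof. by apply: sumr_ge0 => i _; rewrite -expr2 sqr_ge0. Qed.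

Lemma tdotZl n s (x y : n.-tuple R) : tdot (scal s x) y = s * tdot x y.
Proof. by rewrite /tdot mulr_sumr; apply: eq_bigr => i _; rewrite tnth_mktuple mulrA. Qed.

Lemma tdotZr n s (x y : n.-tuple R) : tdot x (scal s y) = s * tdot x y.
Proof. by rewrite /tdot mulr_sumr; apply: eq_bigr => i _; rewrite tnth_mktuple mulrCA. Qed.

Lemma tdotC n (x y : n.-tuple R) : tdot x y = tdot y x.
Proof. by apply: eq_bigr => i _; rewrite mulrC. Qed.

Lemma tdotBr n (x y z : n.-tuple R) : tdot x (sub y z) = tdot x y - tdot x z.
Proof. by rewrite /tdot -sumrB; apply: eq_bigr => i _; rewrite tnth_mktuple mulrBr. Qed.

Lemma tdotBl n (x y z : n.-tuple R) : tdot (sub y z) x = tdot y x - tdot z x.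
Proof. by rewrite tdotC tdotBr !(tdotC x). Qed.

Lemma nsqZ n s (x : n.-tuple R) : nsq (scal s x) = s ^+ 2 * nsq x.
Proof. by rewrite /nsq tdotZl tdotZr mulrA -expr2. Qed.

Lemma nsqB n (x y : n.-tuple R) : nsq (sub x y) = nsq x - 2 * tdot x y + nsq y.
Proof. by rewrite /nsq tdotBl !tdotBr (tdotC y x); ring. Qed.

Lemma scalA n s r (x : n.-tuple R) : scal s (scal r x) = scal (s * r) x.
Proof. by apply: eq_from_tnth => i; rewrite !tnth_mktuple mulrA. Qed.

Lemma scal1 n (x : n.-tuple R) : scal 1 x = x.
Proof. by apply: eq_from_tnth => i; rewrite !tnth_mktuple mul1r. Qed.

Lemma tdot_snoc n t s (x y : n.-tuple R) :
  tdot (snoc (t, x)) (snoc (s, y)) = tdot x y + t * s.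
Proof.
rewrite /tdot big_ord_recr /= !tnth_snoc insubF ?ltnn//=; congr (_ + _).
apply: eq_bigr => i _; rewrite !tnth_snoc /=.
by case: insubP => [j _ ji|]; [rewrite (_ : j = i)//; exact: val_inj|rewrite ltn_ord].
Qed.

Lemma snoc_surj n (w : n.+1.-tuple R) : exists s y, w = snoc (s, y).
Proof.
exists (tnth w ord_max), [tuple tnth w (widen_ord (leqnSn n) i) | i < n].
apply: eq_from_tnth => i; rewrite tnth_snoc.
case: insubP => [j _ ji|] /=; first by rewrite tnth_mktuple; congr tnth; exact: val_inj.
by rewrite -leqNgt => ni; congr tnth; apply/val_inj/eqP; rewrite eqn_leq ni -ltnS ltn_ord.
Qed.

Lemma scal_snoc n s t (x : n.-tuple R) : scal s (snoc (t, x)) = snoc (s * t, scal s x).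
Proof.
apply: eq_from_tnth => i; rewrite tnth_mktuple !tnth_snoc.
by case: insubP => [j _ _|] //=; rewrite tnth_mktuple.
Qed.

Lemma sub_snoc n s t (x y : n.-tuple R) :
  sub (snoc (t, x)) (snoc (s, y)) = snoc (t - s, sub x y).
Proof.
apply: eq_from_tnth => i; rewrite tnth_mktuple !tnth_snoc.
by case: insubP => [j _ _|] //=; rewrite tnth_mktuple.
Qed.

Lemma nsq_snoc n t (x : n.-tuple R) : nsq (snoc (t, x)) = nsq x + t ^+ 2.
Proof. by rewrite /nsq tdot_snoc. Qed.

Local Open Scope ereal_scope.

Lemma ge0_integral_nu_scal n (s : R) (f : n.-tuple R -> \bar R) : (0 < s)%R ->
  (forall x, 0 <= f x) -> measurable_fun setT f ->
  \int[nu n]_x f (scal s x) = ((s^-1) ^+ n)%:E * \int[nu n]_x f x.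
Proof.
move=> s0; elim: n f => [|n IH] f f0 mf.
  have mfs : measurable_fun setT (fun x : 0.-tuple R => f (scal s x)).
    by apply: (measurableT_comp mf); apply: measurable_scal.
  by rewrite !nu0// mul1e; congr f; apply: eq_from_tnth => -[].
have mfs : measurable_fun setT (fun x : n.+1.-tuple R => f (scal s x)).
  by apply: (measurableT_comp mf); apply: measurable_scal.
have mf2 := measurableT_comp mf (@measurable_snoc R n).
rewrite !nuS//.
have mg : measurable_fun setT (fun t : R => \int[nu n]_x f (snoc (t, x))).
  exact: (measurable_integral_param (nu n) (f := fun t x => f (snoc (t, x))) mf2).
transitivity (\int[leb]_t (((s^-1) ^+ n)%:E * (\int[nu n]_x f (snoc ((s * t + 0)%R, x))))).
  apply: eq_integral => t _; rewrite -(IH (fun x => f (snoc (s * t + 0, x)%R)))//.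
    by apply: eq_integral => x _; rewrite scal_snoc addr0.
  exact: (measurableT_comp mf2 (pair1_measurable _)).
rewrite integralTZl; first last.
- by move=> t; apply: integral_ge0 => x _.
- apply: (measurableT_comp mg); exact: measurable_affine.
- by rewrite exprn_ge0// invr_ge0 ltW.
rewrite (ge0_integral_affine_pos _ s0 mg); last by move=> t; apply: integral_ge0.
by rewrite muleA -EFinM exprSr.
Qed.

Lemma integral_gauss1 (a c : R) : (0 < a)%R ->
  \int[leb]_t (expR (- (a * (t - c) ^+ 2)))%:E = (Num.sqrt (pi / a))%:E.
Proof.
move=> a0; have sa : (0 < Num.sqrt a)%R by rewrite sqrtr_gt0.
transitivity (\int[leb]_t (gauss_fun (Num.sqrt a * t + - (Num.sqrt a * c)))%:E).
  apply: eq_integral => t _; rewrite /gauss_fun -mulrBr exprMn sqr_sqrtr// ltW//.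
have mg : measurable_fun setT (fun t : R => (gauss_fun t)%:E).
  by apply/measurable_EFinP; exact: measurable_gauss_fun.
rewrite (ge0_integral_affine_pos _ sa mg); last first.
  by move=> t; rewrite lee_fin gauss_fun_ge0.
rewrite integralT_gauss -EFinM sqrtrM ?pi_ge0// sqrtrV ?ltW//.
by rewrite mulrC.
Qed.

Lemma integral_expN_sqr : \int[leb]_t (expR (- t ^+ 2))%:E = (Num.sqrt pi)%:E.
Proof.
have := integral_gauss1 0 ltr01; rewrite divr1 => <-.
by apply: eq_integral => t _; rewrite mul1r subr0.
Qed.

Lemma integral_nu_gauss n (a : R) (u : n.-tuple R) : (0 < a)%R ->
  \int[nu n]_x (expR (- (a * nsq (sub x u))))%:E = (Num.sqrt (pi / a) ^+ n)%:E.
Proof.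
move=> a0; have mF m (v : m.-tuple R) : measurable_fun setT
    (fun x => (expR (- (a * nsq (sub x v))))%:E).
  by mm; apply: measurable_nsq; apply: measurable_sub; mm.
elim: n u => [|n IH] u.
  by rewrite nu0//= /nsq /tdot big_ord0 mulr0 oppr0 expR0.
rewrite nuS//; have [c [v ->]] := snoc_surj u.
transitivity (\int[leb]_t ((Num.sqrt (pi / a) ^+ n)%:E * (expR (- (a * (t - c) ^+ 2)))%:E)).
  apply: eq_integral => t _.
  rewrite -(IH v) -integralTZr//= ?lee_fin ?expR_ge0//; last exact: mF.
  apply: eq_integral => x _; rewrite -EFinM -expRD sub_snoc nsq_snoc.
  by congr (expR _)%:E; ring.
rewrite integralTZl ?exprn_ge0 ?sqrtr_ge0//; last by mm.
by rewrite integral_gauss1// -EFinM exprSr.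
Qed.

(** Rotation invariance of the plane Gaussian, obtained without rotations: substitute
    [u = a s + b t] for [t], exchange the integrals and integrate out [s]. The substitution divides
    by [b], so [b = 0] is treated apart. *)
Lemma integral_gauss_plane (a b : R) (h : R -> \bar R) :
  measurable_fun setT h -> (forall t, 0 <= h t) ->
  \int[leb]_s ((expR (- s ^+ 2))%:E *
     \int[leb]_t ((expR (- t ^+ 2))%:E * h (a * s + b * t)%R)) =
  (Num.sqrt pi)%:E *
     \int[leb]_u ((expR (- u ^+ 2))%:E * h (Num.sqrt (a ^+ 2 + b ^+ 2) * u)%R).
Proof.
move=> mh h0.
case: (eqVneq b 0%R) => [->|b0].
  have E s : \int[leb]_t ((expR (- t ^+ 2))%:E * h (a * s + 0 * t)%R) =
      (Num.sqrt pi)%:E * h (a * s)%R.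
    under eq_integral do rewrite mul0r addr0.
    rewrite integralTZr//; last by mm.
    by rewrite integral_expN_sqr.
  under eq_integral do rewrite E muleCA.
  rewrite integralTZl; first last.
  - by pos.
  - by mm.
  - by pos.
  congr (_ * _); rewrite expr0n addr0 sqrtr_sqr.
  case: (leP 0%R a) => a0; first by rewrite ?ger0_norm.
  rewrite ltr0_norm// -[RHS]ge0_integral_opp.
  - by apply: eq_integral => t _; rewrite sqrrN mulrNN.
  - by mm.
  - by pos.
set r := Num.sqrt (a ^+ 2 + b ^+ 2).
have r2 : (r ^+ 2 = a ^+ 2 + b ^+ 2)%R by rewrite sqr_sqrtr// addr_ge0// sqr_ge0.
have r0 : (0 < r)%R by rewrite sqrtr_gt0 ltr_wpDl ?sqr_ge0// exprn_even_gt0.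
pose G s u := (expR (- s ^+ 2))%:E * ((expR (- ((u - a * s) / b) ^+ 2))%:E * h u).
have G0 s u : 0 <= G s u by rewrite /G; pos.
have mG : measurable_fun setT (fun p : R * R => G p.1 p.2) by rewrite /G; mm.
have mG1 u : measurable_fun setT (G u) by rewrite /G; mm.
transitivity (\int[leb]_s ((`|b|^-1)%:E * \int[leb]_u G s u)).
  apply: eq_integral => s _.
  rewrite -(ge0_integral_affine (a * s) b0 (mG1 s))//.
  rewrite -integralTZl; first last.
  - by pos.
  - by mm.
  - by pos.
  apply: eq_integral => t _; rewrite /G; congr (_ * (_ * _)).
    by rewrite addrK [X in (X / _)%R]mulrC mulfK.
  by rewrite addrC.
rewrite integralTZl; first last.
- by pos.
- exact: (measurable_integral_param leb mG).
- by pos.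
rewrite (integral_swap leb leb mG)//=.
transitivity ((`|b|^-1)%:E * \int[leb]_u ((Num.sqrt pi * `|b| / r)%:E *
    ((expR (- (r^-1 * u + 0) ^+ 2))%:E * h (r * (r^-1 * u + 0))%R))).
  congr (_ * _); apply: eq_integral => u _.
  rewrite addr0 mulVKf ?gt_eqF//.
  (* Completing the square in [s]: [s^2 + ((u - a s) / b)^2 = (r^2 / b^2) (s - a u / r^2)^2 + u^2 /
     r^2]. *)
  transitivity (\int[leb]_s ((expR (- ((r ^+ 2 / b ^+ 2) * (s - a * u / r ^+ 2) ^+ 2)))%:E *
      ((expR (- (r^-1 * u) ^+ 2))%:E * h u))).
    apply: eq_integral => s _; rewrite /G !muleA -!EFinM -!expRD; congr ((expR _)%:E * _).
    have : (r ^+ 2 != 0)%R by rewrite expf_neq0// gt_eqF.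
    rewrite r2 => r2n0.
    have -> : (- (r^-1 * u) ^+ 2 = - (u ^+ 2 / (a ^+ 2 + b ^+ 2)))%R.
      by rewrite -r2; field; rewrite gt_eqF.
    by field; rewrite ?b0 ?r2n0.
  rewrite integralTZr; first last.
  - by move=> s; rewrite lee_fin expR_ge0.
  - by mm.
  - by rewrite mule_ge0// lee_fin expR_ge0.
  rewrite integral_gauss1; last by rewrite divr_gt0// exprn_even_gt0//= gt_eqF.
  congr (_%:E * _).
  rewrite invf_div mulrA sqrtrM; last by rewrite mulr_ge0 ?pi_ge0 ?sqr_ge0.
  by rewrite sqrtrM ?pi_ge0// sqrtr_sqr sqrtrV ?sqr_ge0// sqrtr_sqr (gtr0_norm r0).
rewrite integralTZl; first last.
- by pos.
- by mm.
- by rewrite divr_ge0 ?mulr_ge0 ?sqrtr_ge0// ltW.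
have ri0 : (0 < r^-1)%R by rewrite invr_gt0.
have mk : measurable_fun setT (fun v : R => (expR (- v ^+ 2))%:E * h (r * v)%R) by mm.
rewrite (ge0_integral_affine_pos 0 ri0 mk) ?invrK; last by pos.
rewrite !muleA -!EFinM; congr (_%:E * _).
by field; rewrite normr_eq0 b0 gt_eqF.
Qed.

(** The projection of a Gaussian vector on [w] is a Gaussian of scale [|w|]: each new coordinate is
    merged with the previous ones by the planar case. The constant is written as a quotient rather
    than a power [n - 1] so that [n = 0] is included. *)
Lemma integral_gauss_marginal n (w : n.-tuple R) (h : R -> \bar R) :
  measurable_fun setT h -> (forall t, 0 <= h t) ->
  \int[nu n]_x ((expR (- nsq x))%:E * h (tdot x w)) =
  (Num.sqrt pi ^+ n / Num.sqrt pi)%:E *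
    \int[leb]_t ((expR (- t ^+ 2))%:E * h (Num.sqrt (nsq w) * t)%R).
Proof.
have spi : (0 < Num.sqrt (pi : R))%R by rewrite sqrtr_gt0 pi_gt0.
elim: n w h => [|n IH] w h mh h0.
  rewrite nu0//; first last.
  - by mm; [exact: measurable_nsq|exact: measurable_tdot].
  - by move=> x; rewrite mule_ge0// lee_fin expR_ge0.
  rewrite /nsq /tdot !big_ord0 oppr0 expR0 mul1e sqrtr0.
  under eq_integral do rewrite mul0r.
  rewrite integralTZr//; last by mm.
  rewrite integral_expN_sqr.
  by rewrite muleA -EFinM expr0 mul1r mulVf ?gt_eqF// mul1e.
have [s [v ->]] := snoc_surj w.
rewrite nuS; first last.
- by mm; [exact: measurable_nsq|exact: measurable_tdot].
- by move=> x; rewrite mule_ge0// lee_fin expR_ge0.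
transitivity (\int[leb]_t ((Num.sqrt pi ^+ n / Num.sqrt pi)%:E * ((expR (- t ^+ 2))%:E *
   \int[leb]_u ((expR (- u ^+ 2))%:E * h (s * t + Num.sqrt (nsq v) * u)%R)))).
  apply: eq_integral => t _.
  have mht : measurable_fun setT (fun u : R => h (s * t + u)%R).
    by mm.
  rewrite muleCA -(IH v _ mht)//.
  rewrite -integralTZl; first last.
  - by pos.
  - by mm; [exact: measurable_nsq|exact: measurable_tdot].
  - by pos.
  apply: eq_integral => x _; rewrite muleA -EFinM -expRD nsq_snoc tdot_snoc.
  by rewrite opprD [X in expR X]addrC [X in h X]addrC (mulrC t).
rewrite integralTZl; first last.
- by pos.
- have mk : measurable_fun setT (fun p : R * R =>
      (expR (- p.2 ^+ 2))%:E * h (s * p.1 + Num.sqrt (nsq v) * p.2)%R).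
    by mm.
  mm; apply: (measurable_integral_param leb (f := fun t u =>
    (expR (- u ^+ 2))%:E * h (s * t + Num.sqrt (nsq v) * u)%R) mk).
  by pos.
- by pos.
rewrite integral_gauss_plane// muleA -EFinM nsq_snoc; congr (_%:E * _).
  by rewrite exprSr mulrAC.
by apply: eq_integral => t _; rewrite sqr_sqrtr ?nsq_ge0// addrC.
Qed.

End tuple_space.

Ltac mext ::= match goal with
 | |- measurable_fun _ (fun x => nsq (@?f x)) => apply: measurable_nsq
 | |- measurable_fun _ (fun x => tdot (@?f x) (@?g x)) => apply: measurable_tdot
 | |- measurable_fun _ (fun x => sub (@?f x) (@?g x)) => apply: measurable_sub
 | |- measurable_fun _ (fun x => scal (@?f x) (@?g x)) => apply: measurable_scal
 | |- measurable_fun _ (@nsq ?R ?n) => exact: (measurable_nsq (@measurable_id _ _ _))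
 | |- measurable_fun _ (tdot ?w) => exact: (measurable_tdot (measurable_cst w) (@measurable_id _ _ _))
 | |- measurable_fun _ (sub ?w) => exact: (measurable_sub (measurable_cst w) (@measurable_id _ _ _))
 | |- measurable_fun _ (scal ?w) => exact: (measurable_scal (measurable_cst w) (@measurable_id _ _ _))
 end.

(** * The unit ball and homogeneous functions *)

Section ball.
Context {R : realType} {n : nat}.
Local Notation leb := (@lebesgue_measure R).
Local Notation X := (n.-tuple R).
Implicit Types (x y z : X).
Local Open Scope ereal_scope.

Lemma measurable_natb d (T : measurableType d) (b : T -> bool) :
  measurable_fun setT b -> measurable_fun setT (fun t => (b t)%:R : R).
Proof.
move=> mb; rewrite (_ : (fun t => _) = fun t => if b t then 1%R else 0%R).
  exact: measurable_fun_ifT.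
by apply/funext => t; case: (b t).
Qed.

Definition inball x : R := (nsq x <= 1)%R%:R.

Lemma inball_ge0 x : (0 <= inball x)%R.
Proof. exact: ler0n. Qed.

Lemma measurable_inball d (T : measurableType d) (f : T -> X) :
  measurable_fun setT f -> measurable_fun setT (fun t => inball (f t)).
Proof.
by move=> mf; apply: measurable_natb; apply: measurable_fun_ler; mm.
Qed.

(** A dilation contributes [s ^+ n] through the Jacobian and [s ^+ k] through homogeneity. The
    factor [phi] will be a Gaussian or the indicator of a ball. *)
Lemma integral_nu_homog (k : nat) (f : X -> \bar R) (phi : X -> R) (s : R) :
  (0 < s)%R -> (forall x, 0 <= f x) -> measurable_fun setT f ->
  (forall x, 0 <= phi x)%R -> measurable_fun setT phi ->
  (forall s x, (0 < s)%R -> f (scal s x) = (s ^+ k)%:E * f x) ->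
  \int[nu n]_x ((phi x)%:E * f x) =
  (s ^+ (n + k))%:E * \int[nu n]_x ((phi (scal s x))%:E * f x).
Proof.
move=> s0 f0 mf phi0 mphi fh.
have mg : measurable_fun setT (fun x => (phi x)%:E * f x) by mm.
have mgs : measurable_fun setT (fun x => (phi (scal s x))%:E * f x).
  by mm.
transitivity ((s ^+ n)%:E * \int[nu n]_x ((phi (scal s x))%:E * f (scal s x))).
  rewrite (ge0_integral_nu_scal s0 _ mg); last by move=> x; rewrite mule_ge0// lee_fin.
  by rewrite muleA -EFinM -exprMn mulfV ?gt_eqF// expr1n mul1e.
rewrite exprD EFinM -muleA; congr (_ * _); rewrite -integralTZl; first last.
- by move=> x; rewrite mule_ge0// lee_fin.
- exact: mgs.
- by rewrite exprn_ge0// ltW.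
by apply: eq_integral => x _; rewrite fh// muleCA.
Qed.

(* Splitting at a radius [r] so large that the Gaussian tail is at most half of the whole integral. *)
Lemma homog_gauss_le (k : nat) : exists C : R, (0 < C)%R /\ forall f : X -> \bar R,
  (forall x, 0 <= f x) -> measurable_fun setT f ->
  (forall s x, (0 < s)%R -> f (scal s x) = (s ^+ k)%:E * f x) ->
  \int[nu n]_x ((expR (- nsq x))%:E * f x) < +oo ->
  \int[nu n]_x ((expR (- nsq x))%:E * f x) <= C%:E * \int[nu n]_x ((inball x)%:E * f x).
Proof.
pose m := (n + k)%N.
pose r : R := (2 ^+ m.+2)%R.
have r1 : (1 <= r)%R by rewrite exprn_ege1// ler1n.
have r0 : (0 < r)%R by exact: lt_le_trans r1.
(* Beyond radius [r], three quarters of the exponent give [exp(-|x|^2) <= e exp(-|x|^2 / 4)]; by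
   homogeneity the wider Gaussian has integral [2 ^+ m] times the original, so [e_small] is what
   makes the tail at most one half. *)
pose e : R := (expR (- (3 / 4 * r ^+ 2)))%R.
have e_small : (e * 2 ^+ m <= 2^-1)%R.
  rewrite /e expRN mulrC ler_pdivrMr ?expR_gt0//.
  have h := expR_ge1Dx (3 / 4 * r ^+ 2).
  have h2 : (r <= r ^+ 2)%R by rewrite expr2 ler_peMl// ltW.
  have h3 : (r = 2 ^+ m * 4)%R by rewrite /r !exprS; ring.
  have h4 : (0 < 2 ^+ m :> R)%R by rewrite exprn_gt0.
  nra.
exists (2 * r ^+ m)%R; split; first by rewrite mulr_gt0// exprn_gt0.
move=> f f0 mf fh Jfin.
have mnsq : measurable_fun setT (fun x : X => nsq x) by apply: measurable_nsq; mm.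
set J := \int[nu n]_x _ in Jfin *; set I := \int[nu n]_x _.
have J0 : 0 <= J by rewrite /J; pos.
have I0 : 0 <= I by apply: integral_ge0 => x _; rewrite mule_ge0// lee_fin inball_ge0.
have A : \int[nu n]_x ((expR (- (nsq x / 4)))%:E * f x) = (2 ^+ m)%:E * J.
  have mp : measurable_fun setT (fun x : X => expR (- (nsq x / 4))) by mm.
  rewrite (integral_nu_homog (ltr0n R 2) f0 mf (fun x => expR_ge0 _) mp fh).
  rewrite -/m; apply: (congr1 (mule _)); apply: eq_integral => x _.
  by rewrite nsqZ; congr ((expR _)%:E * _); field.
pose phi x : R := (nsq x <= r ^+ 2)%R%:R.
have mphi : measurable_fun setT phi.
  by apply: measurable_natb; apply: measurable_fun_ler; mm.
have B : \int[nu n]_x ((phi x)%:E * f x) = (r ^+ m)%:E * I.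
  rewrite (integral_nu_homog r0 f0 mf (fun x => ler0n _ _) mphi fh).
  rewrite -/m; apply: (congr1 (mule _)); apply: eq_integral => x _.
  by rewrite /phi /inball nsqZ -[X in (_ <= X)%R]mulr1 ler_pM2l// exprn_gt0.
have phi0 x : 0 <= (phi x)%:E * f x by rewrite mule_ge0// lee_fin ler0n.
have H : J <= (r ^+ m)%:E * I + e%:E * ((2 ^+ m)%:E * J).
  rewrite -A -B -integralTZl; first last.
  - by pos.
  - by mm.
  - exact: expR_ge0.
  rewrite -integralTD; first last.
  - by rewrite /e; pos.
  - by mm.
  - by [].
  - by mm.
  apply: le_integralT.
  - by mm.
  - by pos.
  - by apply: emeasurable_funD; mm.
  move=> x; rewrite muleA -ge0_muleDl ?lee_fin ?ler0n ?mulr_ge0 ?expR_ge0//.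
  rewrite -EFinM -EFinD; apply: lee_wpmul2r => //; rewrite lee_fin /phi /e -expRD.
  have [_|rx] := leP (nsq x) (r ^+ 2)%R; last by rewrite add0r ler_expR; lra.
  have : (expR (- nsq x) <= expR 0)%R by rewrite ler_expR oppr_le0 nsq_ge0.
  by rewrite expR0 => /le_trans; apply; rewrite lerDl expR_ge0.
(* Finiteness of [J] allows the tail, at most [J / 2], to be absorbed on the left. *)
have Jf : J \is a fin_num by rewrite ge0_fin_numE.
move: H; rewrite -(fineK Jf).
clear B; clearbody I; case: I I0 => [i| |] //= i0; last first.
  by move=> _; rewrite gt0_muley ?leey// lte_fin mulr_gt0// exprn_gt0.
rewrite -!EFinM -EFinD !lee_fin.
have J0' : (0 <= fine J)%R by rewrite fine_ge0.
move=> H; have := ler_wpM2r J0' e_small; rewrite -!mulrA; lra.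
Qed.

(** Positive because the ball integral controls the Gaussian integral of the constant 1 (homogeneity
    of degree 0); finite because the indicator is at most [e exp(-|x|^2)]. *)
Lemma ball_volume_ex : exists V : R, (0 < V)%R /\
  \int[nu n]_x (inball x)%:E = V%:E.
Proof.
have G : \int[nu n]_x (expR (- nsq x))%:E = (Num.sqrt (pi : R) ^+ n)%:E.
  rewrite -(divr1 (pi : R)) -(integral_nu_gauss (scal 0 [tuple 0%R | i < n]) ltr01).
  apply: eq_integral => x _; rewrite mul1r; congr (expR (- _))%:E; congr nsq.
  by apply: eq_from_tnth => i; rewrite !tnth_mktuple mul0r subr0.
have mnsq : measurable_fun setT (fun x : X => nsq x) by apply: measurable_nsq; mm.
have mb : measurable_fun setT (fun x : X => inball x) by apply: measurable_inball; mm.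
have [C [C0 H]] := homog_gauss_le 0.
have H1 : (Num.sqrt (pi : R) ^+ n)%:E <= C%:E * \int[nu n]_x (inball x)%:E.
  have E1 (g : X -> R) : \int[nu n]_x ((g x)%:E * cst 1 x) = \int[nu n]_x (g x)%:E.
    by apply: eq_integral => x _; rewrite mule1.
  rewrite -G -(E1 (fun x => expR (- nsq x))) -(E1 inball); apply: H.
  - by move=> x; exact: lee01.
  - exact: measurable_cst.
  - by move=> s x _; rewrite expr0 mule1.
  - by rewrite (E1 (fun x => expR (- nsq x))) G ltry.
have fin : \int[nu n]_x (inball x)%:E <= (expR 1 * Num.sqrt pi ^+ n)%:E.
  rewrite EFinM -G -integralTZl; first last.
  - by pos.
  - by mm.
  - exact: expR_ge0.
  apply: le_integralT.
  - by mm.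
  - by move=> x; rewrite lee_fin inball_ge0.
  - by mm.
  move=> x; rewrite -EFinM lee_fin -expRD /inball; have [h|h] := leP (nsq x) 1%R.
    have h0 : (expR 0 <= expR (1 - nsq x))%R by rewrite ler_expR subr_ge0.
    by rewrite expR0 in h0.
  exact: expR_ge0.
have pos : 0 <= \int[nu n]_x (inball x)%:E.
  by apply: integral_ge0 => x _; rewrite lee_fin inball_ge0.
move: H1; case: (\int[nu n]_x _) fin pos => [v| |]//= _ v0.
rewrite -EFinM lee_fin => Cv; exists v; split => //.
rewrite lt_neqAle -lee_fin v0 andbT; apply/eqP => v00.
move: Cv; rewrite -v00 mulr0 leNgt exprn_gt0// sqrtr_gt0 pi_gt0//.
Qed.

End ball.

(** * Normalized surface measure as a probability *)

Definition restr_measure d (T : measurableType d) (R : realType)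
    (m : {measure set T -> \bar R}) (D : set T) (mD : measurable D) :
  {measure set T -> \bar R} :=
  measure_function_mrestr__canonical__measure_function_Measure m mD.

Section sphere.
Context {R : realType} {n : nat}.
Local Notation leb := (@lebesgue_measure R).
Local Notation X := (n.-tuple R).
Implicit Types (x y z : X).
Local Open Scope ereal_scope.

Lemma ge0_integral_restr d (T : measurableType d) (m : {measure set T -> \bar R})
    (D : set T) (mD : measurable D) (f : T -> \bar R) :
  measurable_fun setT f -> (forall t, 0 <= f t) ->
  \int[restr_measure m mD]_t f t = \int[m]_(t in D) f t.
Proof.
move=> mf f0; rewrite -{1}(setvU D) ge0_integral_setU//=; first last.
- by rewrite disj_set2E setICl.
- by rewrite setvU.
- exact: measurableC.
rewrite [X in X + _ = _](_ : _ = 0); last first.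
  apply: (null_set_integral (mu := restr_measure m mD)).
  - exact: measurableC.
  - exact: measurable_funTS.
  - by rewrite /= /mrestr setICl measure0.
rewrite add0e; apply: (eq_measure_integral m) => A mA AD /=.
by rewrite /mrestr setIidl.
Qed.

Definition ball1 : set X := [set x | (nsq x <= 1)%R].

Lemma inballE x : inball x = \1_ball1 x.
Proof.
rewrite indicE /inball.
by have -> : (nsq x <= 1)%R = (x \in ball1) by apply/idP/idP; rewrite inE.
Qed.

Lemma measurable_ball1 : measurable ball1.
Proof.
rewrite -[X in measurable X]setTI.
rewrite (_ : ball1 = (fun x : X => nsq x <= 1)%R @^-1` [set true]) //.
by apply: measurable_fun_ler => //; mm.
Qed.

Lemma integral_ball1 (f : X -> \bar R) :
  \int[nu n]_(x in ball1) f x = \int[nu n]_x ((inball x)%:E * f x).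
Proof.
rewrite integral_mkcond; apply: eq_integral => x _; rewrite inballE indicE patchE.
by case: ifPn => _; rewrite ?mul1e ?mul0e.
Qed.

Definition ballV : R := fine (\int[nu n]_x (inball x)%:E).

Lemma ballVE : \int[nu n]_x (inball x)%:E = ballV%:E.
Proof. by rewrite /ballV; have [V [_ ->]] := @ball_volume_ex R n. Qed.

Lemma ballV_gt0 : (0 < ballV)%R.
Proof. by rewrite /ballV; have [V [V0 ->]] := @ball_volume_ex R n. Qed.

(** As the inverse of 0 is 0, the origin is mapped to itself; hence [unit x] is in general only
    known to lie in the unit ball, and the later arguments ask for no more. *)
Definition unit x : X := scal (Num.sqrt (nsq x))^-1 x.

Lemma measurable_unit : measurable_fun setT unit.
Proof.
rewrite (_ : unit = fun x => scal ((nsq x `^ 2^-1) `^ (-1)) x).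
  apply: measurable_scal; last by mm.
  apply: (measurableT_comp (@measurable_powR R (-1)%R)).
  by apply: (measurableT_comp (@measurable_powR R (2^-1)%R)); mm.
by apply/funext => x; rewrite powR12_sqrt ?nsq_ge0// powR_inv1// sqrtr_ge0.
Qed.

Lemma nsq_unit_le x : (nsq (unit x) <= 1)%R.
Proof.
rewrite /unit nsqZ exprVn sqr_sqrtr ?nsq_ge0//.
by have [->|h] := eqVneq (nsq x) 0%R; rewrite ?mulr0// mulVf.
Qed.

Lemma sphere_prob_ex : exists P : probability X R, forall f : X -> \bar R,
  (forall x, 0 <= f x) -> measurable_fun setT f ->
  \int[P]_x f x = (ballV^-1)%:E * \int[nu n]_x ((inball x)%:E * f (unit x)).
Proof.
pose m := push_measure (restr_measure (nu n) measurable_ball1) measurable_unit.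
have mV : m setT = ballV%:E.
  rewrite /= /pushforward /= /mrestr setTI -ballVE.
  under eq_integral do rewrite inballE.
  by rewrite integral_indic// ?setIT//; exact: measurable_ball1.
(* The Dirac mass is only the default of [mnormalize] for null or infinite measures; here the mass
   [ballV] is positive and finite. *)
exists (mnormalize m (dirac (scal 0 [tuple 0%R | i < n]))) => f f0 mf.
have V0 : (0 <= ballV^-1)%R by rewrite invr_ge0 ltW// ballV_gt0.
transitivity (\int[mscale (NngNum V0) m]_x f x).
  apply: eq_measure_integral => A mA _; rewrite /= /mnormalize.
  rewrite [X in if X then _ else _](_ : _ = false); last first.
    by rewrite -/(m setT) mV /= orbF; apply/negbTE; rewrite eqe gt_eqF// ballV_gt0.
  by rewrite -/(m setT) mV /= /mscale /= muleC.
rewrite ge0_integral_mscale//= (ge0_integral_push _ measurable_unit mf f0).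
rewrite ge0_integral_restr//; first by rewrite integral_ball1.
exact: (measurableT_comp mf measurable_unit).
Qed.

Definition sphereP : probability X R := projT1 (cid sphere_prob_ex).

Lemma integral_sphereP (f : X -> \bar R) :
  (forall x, 0 <= f x) -> measurable_fun setT f ->
  \int[sphereP]_x f x = (ballV^-1)%:E * \int[nu n]_x ((inball x)%:E * f (unit x)).
Proof. by rewrite /sphereP; case: cid => P /= H; exact: H. Qed.

Definition rv x : 'rV[R]_n := (\row_i tnth x i)%R.

Lemma dotv_rv x y : dotv (rv x) (rv y) = tdot x y.
Proof. by apply: eq_bigr => i _; rewrite !mxE. Qed.

Lemma eucl_rv x : eucl (rv x) = Num.sqrt (nsq x).
Proof. by rewrite /eucl dotv_rv. Qed.

Lemma rv_scal s x : rv (scal s x) = (s *: rv x)%R.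
Proof. by apply/rowP => i; rewrite !mxE tnth_mktuple. Qed.

Lemma lebRn_nu (g : 'rV[R]_n -> \bar R) : (forall v, 0 <= g v) ->
  measurable_fun setT (g \o rv) -> lebRn g = \int[nu n]_x g (rv x).
Proof.
move=> g0 mg; rewrite -iint_tup//; congr iint; apply/funext => x /=.
by congr g; apply/rowP => i; rewrite !mxE tnth_mktuple.
Qed.

Lemma eucl_rv_le1 x : (eucl (rv x) <= 1)%R = (nsq x <= 1)%R.
Proof. by rewrite eucl_rv -[X in (_ <= X)%R]sqrtr1 ler_sqrt. Qed.

Lemma ball_volE : ball_vol R n = ballV%:E.
Proof.
rewrite /ball_vol lebRn_nu; first last.
- rewrite (_ : _ \o _ = fun x => (inball x)%:E).
    by apply/measurable_EFinP; apply: measurable_inball; mm.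
  by apply/funext => x /=; rewrite eucl_rv_le1.
- by move=> v; rewrite lee_fin ler0n.
by rewrite -ballVE; apply: eq_integral => x _; rewrite eucl_rv_le1.
Qed.

Lemma sphere_intE (g : 'rV[R]_n -> \bar R) : (forall v, 0 <= g v) ->
  measurable_fun setT (g \o rv) -> sphere_int g = \int[sphereP]_x g (rv x).
Proof.
move=> g0 mg; rewrite (integral_sphereP (fun x => g0 (rv x)) mg).
have E x : ((eucl (rv x) <= 1)%R%:R)%:E * g ((eucl (rv x))^-1 *: rv x)%R =
    (inball x)%:E * g (rv (unit x)).
  by rewrite eucl_rv_le1 rv_scal eucl_rv.
rewrite /sphere_int ball_volE lebRn_nu; first last.
- rewrite (_ : _ \o _ = fun x => (inball x)%:E * g (rv (unit x))); last by apply/funext => x /=.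
  apply: emeasurable_funM; first by apply/measurable_EFinP; apply: measurable_inball; mm.
  exact: (measurableT_comp mg measurable_unit).
- by move=> v; rewrite mule_ge0// lee_fin ler0n.
rewrite inver gt_eqF ?ballV_gt0// muleC; congr (_ * _).
by apply: eq_integral => x _; rewrite E.
Qed.

End sphere.

(** * Integrals over the line: moments, subordination, layers *)

Section one_dimensional.
Context {R : realType}.
Local Notation leb := (@lebesgue_measure R).
Local Open Scope ereal_scope.

Lemma integral_indic_itv (a b : R) : (a <= b)%R ->
  \int[leb]_t (\1_([set` `[a, b]] : set R) t)%:E = (b - a)%:E.
Proof.
move=> ab; have mA : measurable ([set` `[a, b]] : set R) by exact: measurable_itv.
have lA : leb [set` `[a, b]] = (b - a)%:E.
  rewrite lebesgue_measure_itv/= lte_fin; case: ltP => [_|ba]; first by rewrite -EFinD.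
  by rewrite (le_anti (introT andP (conj ab ba))) subrr.
by rewrite integral_indic// setIT; exact: lA.
Qed.

Lemma integral_ge_itv (f : R -> R) (c a b : R) : measurable_fun setT f ->
  (forall t, 0 <= f t)%R -> (0 <= c)%R -> (a <= b)%R ->
  (forall t, a <= t <= b -> c <= f t)%R -> (c * (b - a))%:E <= \int[leb]_t (f t)%:E.
Proof.
move=> mf f0 c0 ab cf.
have mA : measurable ([set` `[a, b]] : set R) by exact: measurable_itv.
have mi : measurable_fun setT (fun t : R => (\1_([set` `[a, b]] : set R) t)%:E : \bar R).
  by apply/measurable_EFinP; exact: measurable_indic.
rewrite EFinM -(integral_indic_itv ab) -integralTZl//.
apply: le_integralT.
- by apply: emeasurable_funM.
- by move=> t; rewrite -EFinM lee_fin mulr_ge0 ?indicE.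
- by mm.
- move=> t; rewrite -EFinM lee_fin indicE.
  case: (boolP (t \in _)) => [|_]; rewrite ?mulr1 ?mulr0//.
  by rewrite inE /= in_itv/= => h; exact: cf.
Qed.

(** Serves to define constants as integrals: finite by domination, and positive by a lower bound on
    [[1, 2]], away from the singularity of [|t|^-3] at the origin. *)
Lemma integral_pos_fin (f g : R -> R) (c : R) :
  measurable_fun setT f -> (forall t, 0 <= f t)%R ->
  measurable_fun setT g -> (forall t, f t <= g t)%R ->
  \int[leb]_t (g t)%:E < +oo ->
  (0 < c)%R -> (forall t, 1 <= t <= 2 -> c <= f t)%R ->
  exists m : R, (0 < m)%R /\ \int[leb]_t (f t)%:E = m%:E.
Proof.
move=> mf f0 mg fg gfin c0 cf.
have mfE : measurable_fun setT (fun t => (f t)%:E) by apply/measurable_EFinP.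
have H : \int[leb]_t (f t)%:E < +oo.
  apply: le_lt_trans gfin; apply: le_integralT.
  - exact: mfE.
  - by move=> t; rewrite lee_fin.
  - by apply/measurable_EFinP.
  - by move=> t; rewrite lee_fin.
have L : c%:E <= \int[leb]_t (f t)%:E.
  have -> : c = (c * (2 - 1))%R by lra.
  by apply: integral_ge_itv => //; [exact: ltW|lra].
move: L H; case: (\int[leb]_t _) => [m| |]//=.
by rewrite lee_fin => cm _; exists m; split=> //; exact: lt_le_trans cm.
Qed.

Lemma abs_moment_gauss : exists m : R, (0 < m)%R /\
  forall r : R, (0 <= r)%R ->
    \int[leb]_t ((expR (- t ^+ 2))%:E * (`|r * t|%R)%:E) = (m * r)%:E.
Proof.
have mf : measurable_fun setT (fun t : R => expR (- t ^+ 2) * `|t|)%R by mm.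
have [m [m0 mE]] : exists m : R, (0 < m)%R /\
    \int[leb]_t (expR (- t ^+ 2) * `|t|)%:E = m%:E.
  (* Half of the exponent absorbs the moment: [|t| <= 1 + t^2 / 2 <= exp(t^2 / 2)]. *)
  apply: (@integral_pos_fin _ (fun t => expR (- (2^-1 * (t - 0) ^+ 2)))%R (expR (- 4))) => //.
  - by mm.
  - move=> t; rewrite subr0.
    have -> : (- t ^+ 2 = - (2^-1 * t ^+ 2) + - (2^-1 * t ^+ 2))%R by lra.
    rewrite expRD -mulrA ler_piMr ?expR_ge0// mulrC expRN ler_pdivrMr ?expR_gt0// mul1r.
    apply: le_trans (expR_ge1Dx _).
    have -> : (t ^+ 2 = `|t| ^+ 2)%R by rewrite -normrX ger0_norm// sqr_ge0.
    by have := sqr_ge0 (`|t| - 1)%R; rewrite sqrrB; lra.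
  - by rewrite integral_gauss1 ?ltry.
  - move=> t /andP[t1 t2]; rewrite -[leLHS]mulr1 ler_pM ?expR_ge0//.
      by rewrite ler_expR lerN2; nra.
    by rewrite ger0_norm// (le_trans ler01).
exists m; split => // r r0; rewrite mulrC EFinM -mE -integralTZl//; last by apply/measurable_EFinP.
by apply: eq_integral => t _; rewrite -!EFinM normrM (ger0_norm r0); congr EFin; ring.
Qed.

Lemma integral_oneDsqrV_fin : \int[leb]_t (2 / (1 + t ^+ 2))%:E < +oo.
Proof.
have c : continuous (fun t : R => 2 / (1 + t ^+ 2))%R.
  by move=> t; apply: cvgM; [exact: cvg_cst|exact: continuous_oneDsqrV].
have E t : (2 / (1 + t ^+ 2))%:E = 2%:E * ((1 + t ^+ 2)^-1)%:E by [].
rewrite ge0_symfun_integralT//.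
- rewrite (_ : [set x | _] = [set` `[0%R, +oo[]); last first.
    by apply/seteqP; split => x/=; rewrite in_itv/= andbT.
  under eq_integral do rewrite E.
  rewrite ge0_integralZl_EFin//.
  + by rewrite integral0y_oneDsqr -!EFinM ltry.
  + by move=> t _; rewrite lee_fin invr_ge0 addr_ge0// sqr_ge0.
  + apply/measurable_EFinP/measurable_funTS; apply: continuous_measurable_fun.
    exact: continuous_oneDsqrV.
- by move=> t; rewrite divr_ge0// addr_ge0// sqr_ge0.
- by move=> t /=; rewrite sqrrN.
Qed.

Lemma measurable_normV3 : measurable_fun setT (fun t : R => (`|t|^-1 ^+ 3)%R).
Proof.
apply: measurable_funX; rewrite (_ : (fun t : R => _) = fun t : R => (`|t| `^ (-1))%R).
  by apply: (measurableT_comp (@measurable_powR R (-1)%R)); mm.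
by apply/funext => t; rewrite powR_inv1.
Qed.

(* The exponent 4 of [t] is for the sake of [weight] below. *)
Lemma subordination : exists c : R, (0 < c)%R /\ forall r : R, (0 <= r)%R ->
  \int[leb]_t ((`|t|^-1 ^+ 3)%:E * (1 - expR (- (t ^+ 4 * r ^+ 2)))%:E) = (c * r)%:E.
Proof.
have mn := measurable_normV3.
pose h (t : R) := (`|t|^-1 ^+ 3 * (1 - expR (- (t ^+ 4))))%R.
have mh : measurable_fun setT h by rewrite /h; mm.
have h0 t : (0 <= h t)%R.
  rewrite /h mulr_ge0 ?exprn_ge0 ?invr_ge0// subr_ge0 -expR0 ler_expR oppr_le0.
  exact: exprn_even_ge0.
have [c [c0 cE]] : exists c : R, (0 < c)%R /\ \int[leb]_t (h t)%:E = c%:E.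
  apply: (@integral_pos_fin _ (fun t => 2 / (1 + t ^+ 2))%R (8^-1 * (1 - expR (- 1)))%R) => //.
  - apply: continuous_measurable_fun => t.
    by apply: cvgM; [exact: cvg_cst|exact: continuous_oneDsqrV].
  - move=> t; rewrite /h.
    have -> : (t ^+ 4 = `|t| ^+ 4)%R by rewrite -normrX ger0_norm// exprn_even_ge0.
    have -> : (t ^+ 2 = `|t| ^+ 2)%R by rewrite -normrX ger0_norm// exprn_even_ge0.
    have := normr_ge0 t; move: `|t|%R => a a0.
    have d0 : (0 < 1 + a ^+ 2)%R by rewrite ltr_wpDr ?sqr_ge0.
    rewrite ler_pdivlMr//.
    have [->|an0] := eqVneq a 0%R; first by rewrite invr0 expr0n/= !mul0r.
    have ap : (0 < a)%R by rewrite lt_neqAle eq_sym an0.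
    have e1 : (1 - expR (- a ^+ 4) <= a ^+ 4)%R by have := expR_ge1Dx (- a ^+ 4)%R; lra.
    have e2 : (1 - expR (- a ^+ 4) <= 1)%R by rewrite gerBl expR_ge0.
    have i0 : (0 <= a^-1 ^+ 3)%R by rewrite exprn_ge0// invr_ge0.
    (* The bound [a^4] on the numerator makes [h] at most [a] near the origin; the bound 1 makes it
       at most [a^-3] further out. *)
    have [a1|a1] := leP a 1%R.
      apply: (@le_trans _ _ (a * (1 + a ^+ 2))%R).
        apply: ler_wpM2r; first exact: ltW.
        apply: (@le_trans _ _ (a^-1 ^+ 3 * a ^+ 4)%R); first exact: ler_wpM2l.
        by rewrite le_eqVlt; apply/orP; left; apply/eqP; field.
      by nra.
    apply: (@le_trans _ _ (a^-1 ^+ 3 * (1 + a ^+ 2))%R).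
      by apply: ler_wpM2r; [exact: ltW|rewrite ler_piMr].
    rewrite exprVn ler_pdivrMl ?exprn_gt0//.
    have : (1 <= a ^+ 2)%R by rewrite exprn_ege1// ltW.
    have : (a ^+ 2 <= a ^+ 3)%R by rewrite [X in (_ <= X)%R]exprS ler_peMl ?sqr_ge0// ltW.
    by lra.
  - exact: integral_oneDsqrV_fin.
  - move=> t /andP[t1 t2]; rewrite /h.
    have t0 : (0 < t)%R by exact: lt_le_trans t1.
    apply: ler_pM => //.
    + rewrite gtr0_norm// exprVn lef_pV2 ?posrE ?exprn_gt0//.
      have t4 : (t ^+ 2 <= 4)%R by rewrite expr2; nra.
      by rewrite exprS; nra.
    + by rewrite lerB// ler_expR lerN2 exprn_ege1.
exists c; split => // r; rewrite le_eqVlt => /predU1P[<-|r0].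
  rewrite mulr0; apply: integral0_eq => t _.
  by rewrite expr0n/= mulr0 oppr0 expR0 subrr mule0.
pose s := Num.sqrt r.
have s0 : (0 < s)%R by rewrite sqrtr_gt0.
have s2 : (s ^+ 2 = r)%R by rewrite sqr_sqrtr// ltW.
(* Rescaling by [s], the square root of [r], turns [t^4 r^2] into [(s t)^4]. The weight yields [s^3]
   and the measure [s^-1], in total [s^2 = r]. *)
transitivity (\int[leb]_t ((s ^+ 3)%:E * (h (s * t + 0)%R)%:E)).
  apply: eq_integral => t _; rewrite -!EFinM; congr EFin.
  have E3 : (s ^+ 3 * s^-1 ^+ 3 = 1)%R by rewrite -exprMn mulfV ?expr1n// gt_eqF.
  have E4 : (s ^+ 4 = r ^+ 2)%R by rewrite -s2; ring.
  have K (x : R) : (s ^+ 3 * (s^-1 ^+ 3 * x) = x)%R by rewrite mulrA E3 mul1r.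
  rewrite /h addr0 normrM (gtr0_norm s0) invfM !exprMn E4.
  rewrite -[X in _ = (_ * X)%R]mulrA K.
  by congr (_ * (1 - expR (- _)))%R; rewrite mulrC.
have mhE : measurable_fun setT (fun t => (h t)%:E) by apply/measurable_EFinP.
rewrite integralTZl; first last.
- by move=> t; rewrite lee_fin.
- by apply: (measurableT_comp mhE); exact: measurable_affine.
- by rewrite exprn_ge0// ltW.
rewrite (ge0_integral_affine_pos 0 s0 mhE); last by move=> t; rewrite lee_fin.
rewrite cE -!EFinM; congr EFin; rewrite -s2; field.
by rewrite gt_eqF.
Qed.

(** The integrand indicates that [u] separates [s] from [t]. It is written with products of
    indicators so that it factors under a product of probabilities. *)
Lemma abs_dist_layer (s t : R) :
  \int[leb]_u ((u <= s)%R%:R * (1 - (u <= t)%R%:R) + (u <= t)%R%:R * (1 - (u <= s)%R%:R))%:E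
  = (`|s - t|%R)%:E.
Proof.
wlog ts : s t / (t <= s)%R => [H|].
  have [/H //|/ltW st] := leP t s.
  rewrite distrC -(H t s st); apply: eq_integral => u _.
  by congr EFin; rewrite addrC.
pose A : set R := [set` `]t, s]].
have mA : measurable A by exact: measurable_itv.
transitivity (\int[leb]_u (\1_A u)%:E).
  apply: eq_integral => u _; congr EFin; rewrite indicE.
  have -> : (u \in A) = (t < u <= s)%R by apply/idP/idP; rewrite inE /A /= in_itv.
  case: (leP u t) => ut /=; last first.
    by case: leP => us; rewrite /= ?subr0 ?mul0r ?mulr1 ?addr0.
  by rewrite (le_trans ut ts) /= subrr mulr0 addr0.
have lA : leb A = (s - t)%:E.
  rewrite /A lebesgue_measure_itv/= lte_fin; case: ltP => [_|st]; first by rewrite -EFinD.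
  by rewrite (le_anti (introT andP (conj st ts))) subrr.
by rewrite ger0_norm ?subr_ge0// -lA integral_indic// setIT.
Qed.

End one_dimensional.

(** * Gaussian averages over the sphere *)

Section sphere_regularity.
Context {R : realType}.
Local Open Scope ereal_scope.

Lemma nsq_sub_le n (x y z : n.-tuple R) :
  (nsq (sub x z) <= 2 * nsq (sub x y) + 2 * nsq (sub y z))%R.
Proof.
rewrite /nsq /tdot !mulr_sumr -big_split /=; apply: ler_sum => i _.
rewrite !tnth_mktuple.
have := sqr_ge0 (tnth x i - tnth y i - (tnth y i - tnth z i))%R; nra.
Qed.

Lemma unit_scal n s (x : n.-tuple R) : (0 < s)%R -> unit (scal s x) = unit x.
Proof.
move=> s0; rewrite /unit nsqZ sqrtrM ?sqr_ge0// sqrtr_sqr gtr0_norm// scalA; congr scal.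
have [->|h] := eqVneq (Num.sqrt (nsq x)) 0%R; first by rewrite mulr0 invr0 mul0r.
by field; rewrite h gt_eqF.
Qed.

Lemma scal_unit n (x : n.-tuple R) : (0 < nsq x)%R ->
  scal (Num.sqrt (nsq x)) (unit x) = x.
Proof. by move=> x0; rewrite /unit scalA mulfV ?scal1// gt_eqF// sqrtr_gt0. Qed.

(* By homogeneity, the integral of a function of [x/|x|] over the shell [1 < |x| <= 1 + 1/k] is at
   least [1/k] times that over the ball; on the shell the cap kernel at [x/|x|] is comparable to the
   Gaussian in [x]. *)
Lemma sphere_gauss_le (d : nat) : exists C : R, (0 < C)%R /\
  forall (k : R) (z : d.+1.-tuple R), (0 < k)%R ->
  \int[sphereP]_x (expR (- (k ^+ 2 * nsq (sub x z))))%:E <= (C * k^-1 ^+ d)%:E.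
Proof.
pose n := d.+1; pose A : R := Num.sqrt (pi * 2).
have A0 : (0 < A)%R by rewrite sqrtr_gt0 mulr_gt0// pi_gt0.
pose V : R := @ballV R n; have V0 : (0 < V)%R by exact: ballV_gt0.
exists (expR 1 * A ^+ n / V)%R; split.
  by rewrite divr_gt0// mulr_gt0 ?expR_gt0// exprn_gt0.
move=> k z k0; pose s : R := (1 + k^-1)%R.
have ki0 : (0 < k^-1)%R by rewrite invr_gt0.
have s1 : (1 < s)%R by rewrite ltrDl.
have s0 : (0 < s)%R by lra.
have mk : measurable_fun setT (fun x : n.-tuple R => (expR (- (k ^+ 2 * nsq (sub x z))))%:E) by mm.
pose f (x : n.-tuple R) : \bar R := (expR (- (k ^+ 2 * nsq (sub (unit x) z))))%:E.
have mf : measurable_fun setT f by exact: (measurableT_comp mk measurable_unit).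
have f0 x : 0 <= f x by rewrite lee_fin expR_ge0.
have mb : measurable_fun setT (fun x : n.-tuple R => inball x) by apply: measurable_inball; mm.
rewrite integral_sphereP//.
set I := \int[nu n]_x _.
have I0 : 0 <= I by apply: integral_ge0 => x _; rewrite mule_ge0// lee_fin inball_ge0.
have IV : I <= V%:E.
  rewrite /V -ballVE; apply: le_integralT.
  - by mm.
  - by move=> x; rewrite mule_ge0// lee_fin inball_ge0.
  - by mm.
  - move=> x; rewrite -[X in _ <= X]mule1; apply: lee_wpmul2l; first by rewrite lee_fin inball_ge0.
    by rewrite lee_fin -expR0 ler_expR oppr_le0 mulr_ge0 ?sqr_ge0// nsq_ge0.
pose phi (x : n.-tuple R) : R := (nsq x <= s ^+ 2)%R%:R.
have mphi : measurable_fun setT phi.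
  by apply: measurable_natb; apply: measurable_fun_ler; mm.
have E : \int[nu n]_x ((phi x)%:E * f x) = (s ^+ n)%:E * I.
  have fh s' x : (0 < s')%R -> f (scal s' x) = (s' ^+ 0)%:E * f x.
    by move=> s'0; rewrite /f unit_scal// mul1e.
  rewrite (integral_nu_homog s0 f0 mf (fun x => ler0n _ _) mphi fh) addn0.
  apply: (congr1 (mule _)); apply: eq_integral => x _.
  by rewrite /phi /inball nsqZ -[X in (_ <= X)%R]mulr1 ler_pM2l// exprn_gt0.
(* On the shell, [x] is within [k^-1] of [unit x], so [|x - z|^2 <= 2 k^-2 + 2 |unit x - z|^2].
   Halving the exponent thus costs only the factor [expR 1]; the Gaussian of rate [k^2 / 2] has
   integral [(A / k)^n]. *)
have H : (s ^+ n)%:E * I <= I + (expR 1 * (A * k^-1) ^+ n)%:E.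
  rewrite -E; have G := integral_nu_gauss z (_ : 0 < k ^+ 2 / 2)%R.
  have -> : (A * k^-1 = Num.sqrt (pi / (k ^+ 2 / 2)))%R.
    rewrite invf_div mulrA /A [RHS]sqrtrM ?mulr_ge0 ?pi_ge0//.
    by rewrite sqrtrV ?sqr_ge0// sqrtr_sqr gtr0_norm.
  rewrite EFinM -G; last by rewrite divr_gt0// exprn_gt0.
  rewrite -integralTZl; first last.
  - by pos.
  - by mm.
  - by pos.
  rewrite -integralTD; first last.
  - by pos.
  - by mm.
  - by move=> x; rewrite mule_ge0// lee_fin inball_ge0.
  - by mm.
  apply: le_integralT.
  - by mm.
  - by move=> x; rewrite mule_ge0// lee_fin ler0n.
  - by apply: emeasurable_funD; mm.
  move=> x; rewrite -!EFinM -EFinD lee_fin /phi /inball.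
  have [x1|x1] := leP (nsq x) 1%R.
    rewrite (le_trans x1) ?mul1r ?lerDl ?mulr_ge0 ?expR_ge0//.
    by rewrite exprn_ege1// ltW.
  have [xs|xs] := leP (nsq x) (s ^+ 2)%R; last by rewrite !mul0r add0r mulr_ge0 ?expR_ge0.
  rewrite mul1r mul0r add0r -expRD ler_expR.
  have x0 : (0 < nsq x)%R by exact: lt_trans x1.
  have h1 : (nsq (sub x (unit x)) <= k^-1 ^+ 2)%R.
    rewrite -{1}(scal_unit x0).
    have -> : sub (scal (Num.sqrt (nsq x)) (unit x)) (unit x) = scal (Num.sqrt (nsq x) - 1) (unit x).
      by apply: eq_from_tnth => i; rewrite !tnth_mktuple mulrBl mul1r.
    rewrite nsqZ; apply: (@le_trans _ _ ((Num.sqrt (nsq x) - 1) ^+ 2 * 1)%R).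
      by apply: ler_wpM2l; [exact: sqr_ge0|exact: nsq_unit_le].
    have r1 : (1 <= Num.sqrt (nsq x))%R by rewrite -[X in (X <= _)%R]sqrtr1 ler_sqrt ltW.
    have rs : (Num.sqrt (nsq x) <= s)%R.
      by rewrite -(gtr0_norm s0) -sqrtr_sqr ler_sqrt// sqr_ge0.
    have a1 : (0 <= Num.sqrt (nsq x) - 1)%R by rewrite subr_ge0.
    have a2 : (Num.sqrt (nsq x) - 1 <= k^-1)%R by rewrite lerBlDl.
    by rewrite mulr1 !expr2 ler_pM.
  have h2 := nsq_sub_le x (unit x) z.
  have h3 : (k ^+ 2 * k^-1 ^+ 2 = 1)%R by rewrite -exprMn mulfV ?expr1n// gt_eqF.
  have k20 : (0 < k ^+ 2)%R by rewrite exprn_gt0.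
  have := ler_wpM2l (ltW k20) h1; have := ler_wpM2l (ltW k20) h2; rewrite h3; lra.
(* One factor [s] already gives the shell a weight [k^-1]. Dividing by it lowers the exponent of
   [k^-1] from [n = d + 1] to [d], the dimension of the sphere. *)
have bern : (1 + k^-1 <= s ^+ n)%R.
  rewrite /n exprS -[X in (X <= _)%R]mulr1 ler_wpM2l// ?(ltW s0)//.
  by rewrite exprn_ege1// ltW.
move: H; clear E; clearbody I; case: I I0 IV => [i| |]//; rewrite !lee_fin => i0 _.
move=> H.
have Hi : (k^-1 * i <= expR 1 * (A * k^-1) ^+ n)%R.
  by have := ler_wpM2r i0 bern; lra.
have Hi2 : (i <= expR 1 * A ^+ n * k^-1 ^+ d)%R.
  rewrite -(ler_pM2l ki0) (le_trans Hi)// exprMn /n !exprS.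
  by rewrite le_eqVlt; apply/orP; left; apply/eqP; ring.
rewrite mulrAC [X in (_ <= X)%R]mulrC; apply: ler_wpM2l Hi2.
by rewrite invr_ge0 ltW.
Qed.

End sphere_regularity.

(** * Integrals against probabilities and their products *)

Section probability_integral.
Context d (T : measurableType d) (R : realType) (P : probability T R).
Local Open Scope ereal_scope.

Lemma integral_prob_cst (r : R) : \int[P]_x r%:E = r%:E.
Proof. by rewrite integral_cst//= probability_setT mule1. Qed.

Lemma integral_prob_le (f : T -> \bar R) (r : R) : measurable_fun setT f ->
  (forall x, 0 <= f x) -> (forall x, f x <= r%:E) -> \int[P]_x f x <= r%:E.
Proof.
by move=> mf f0 fr; rewrite -(integral_prob_cst r); apply: le_integralT => //; exact: measurable_cst.
Qed.

Lemma integral_prob_fine (f : T -> R) (r : R) : measurable_fun setT f ->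
  (forall x, 0 <= f x <= r)%R ->
  exists s : R, (0 <= s <= r)%R /\ \int[P]_x (f x)%:E = s%:E.
Proof.
move=> mf f01.
have mfE : measurable_fun setT (fun x => (f x)%:E) by apply/measurable_EFinP.
have f0 x : 0 <= (f x)%:E by rewrite lee_fin; case/andP: (f01 x).
have : \int[P]_x (f x)%:E <= r%:E.
  by apply: integral_prob_le => // x; rewrite lee_fin; case/andP: (f01 x).
have : 0 <= \int[P]_x (f x)%:E by apply: integral_ge0.
case: (\int[P]_x _) => [s| |]//; rewrite !lee_fin => s0 sr.
by exists s; rewrite s0 sr.
Qed.

Lemma integral_prob_onem (f : T -> R) (s : R) : measurable_fun setT f ->
  (forall x, 0 <= f x <= 1)%R -> \int[P]_x (f x)%:E = s%:E ->
  \int[P]_x (1 - f x)%:E = (1 - s)%:E.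
Proof.
move=> mf f01 fs.
have : \int[P]_x ((f x)%:E + (1 - f x)%:E) = 1%:E.
  rewrite -[RHS](integral_prob_cst 1); apply: eq_integral => x _.
  by rewrite -EFinD addrC subrK.
rewrite integralTD; first last.
- by move=> x; rewrite lee_fin subr_ge0; case/andP: (f01 x).
- by mm.
- by move=> x; rewrite lee_fin; case/andP: (f01 x).
- by mm.
rewrite fs; case: (\int[P]_x _) => [t| |]//.
by rewrite -EFinD => -[st]; congr EFin; rewrite -st addrC addKr.
Qed.

End probability_integral.

Definition prodP d d' (T : measurableType d) (T' : measurableType d') (R : realType)
    (P : probability T R) (P' : probability T' R) : probability (T * T')%type R :=
  (P \x P')%E.

Lemma integral_prod_mul d d' (T : measurableType d) (T' : measurableType d') (R : realType)
    (P : probability T R) (P' : probability T' R) (f : T -> R) (g : T' -> R) :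
  measurable_fun setT f -> (forall x, 0 <= f x) ->
  measurable_fun setT g -> (forall x, 0 <= g x) ->
  (\int[prodP P P']_p (f p.1 * g p.2)%:E = \int[P]_x (f x)%:E * \int[P']_y (g y)%:E)%E.
Proof.
move=> mf f0 mg g0.
have m1 : measurable_fun setT (fun p : T * T' => ((f p.1 * g p.2)%:E : \bar R)).
  by mm.
have gi0 : (0 <= \int[P']_y (g y)%:E)%E by apply: integral_ge0 => y _; rewrite lee_fin.
rewrite [LHS](integral_prodE P P' (f := fun x y => (f x * g y)%:E) m1); last first.
  by move=> x y; rewrite lee_fin mulr_ge0.
rewrite -integralTZr//; last by apply/measurable_EFinP.
by apply: eq_integral => x _; rewrite -integralTZl//; apply/measurable_EFinP.
Qed.

(** * The discrepancy in one direction as an energy *)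

Section energy.
Context {R : realType} {n : nat}.
Local Notation leb := (@lebesgue_measure R).
Local Notation X := (n.-tuple R).
Implicit Types (x y z : X) (P : probability X R).
Local Open Scope ereal_scope.

Definition capP P x (t : R) : R := fine (\int[P]_y ((t <= tdot x y)%R%:R)%:E).

Let halfspace (t : R) x y : R := (t <= tdot x y)%R%:R.

Lemma measurable_halfspace d (T : measurableType d) (t : T -> R) (f g : T -> X) :
  measurable_fun setT t -> measurable_fun setT f -> measurable_fun setT g ->
  measurable_fun setT (fun u => ((t u <= tdot (f u) (g u))%R%:R : R)).
Proof. by move=> mt mf mg; apply: measurable_natb; apply: measurable_fun_ler; mm. Qed.

Let halfspace01 (t : R) x y : (0 <= halfspace t x y <= 1)%R.
Proof. by rewrite /halfspace; case: (t <= _)%R; rewrite /= ?lexx ?ler01. Qed.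

Let mhalf (t : R) x : measurable_fun setT (halfspace t x).
Proof. by apply: measurable_halfspace; mm. Qed.

Lemma capP_ex P x t : (0 <= capP P x t <= 1)%R /\
  \int[P]_y (halfspace t x y)%:E = (capP P x t)%:E.
Proof.
have [s [s01 E]] := integral_prob_fine P (mhalf t x) (halfspace01 t x).
by rewrite /capP E.
Qed.

Lemma capPE P x t : \int[P]_y ((t <= tdot x y)%R%:R)%:E = (capP P x t)%:E.
Proof. by have [] := capP_ex P x t. Qed.

Lemma capP01 P x t : (0 <= capP P x t <= 1)%R.
Proof. by have [] := capP_ex P x t. Qed.

Lemma measurable_capP P d (T : measurableType d) (f : T -> X) (t : T -> R) :
  measurable_fun setT f -> measurable_fun setT t ->
  measurable_fun setT (fun u => capP P (f u) (t u)).
Proof.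
move=> mf mt; apply/measurable_EFinP.
rewrite (_ : EFin \o _ = fun u => \int[P]_y ((t u <= tdot (f u) y)%R%:R)%:E); last first.
  by apply/funext => u /=; rewrite capPE.
apply: (measurable_integral_param P (f := fun u y => ((t u <= tdot (f u) y)%R%:R)%:E)).
  apply/measurable_EFinP; apply: measurable_halfspace.
  - by apply: (measurableT_comp mt); mm.
  - by apply: (measurableT_comp mf); mm.
  - by mm.
by move=> u y; rewrite lee_fin ler0n.
Qed.

(** Write the distance in layers, exchange the integrals, and use independence of the two points:
    each layer becomes the probability that [t] separates their projections. *)
Lemma integral_dist_cap P P' x :
  \int[prodP P P']_p (`|tdot x p.1 - tdot x p.2|%R)%:E =
  \int[leb]_t (capP P x t * (1 - capP P' x t) + capP P' x t * (1 - capP P x t))%:E.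
Proof.
pose h (p : X * X) (t : R) : R := (halfspace t x p.1 * (1 - halfspace t x p.2) +
                       halfspace t x p.2 * (1 - halfspace t x p.1))%R.
have h0 p t : 0 <= (h p t)%:E.
  have /andP[a0 a1] := halfspace01 t x p.1; have /andP[b0 b1] := halfspace01 t x p.2.
  by rewrite lee_fin addr_ge0// mulr_ge0// subr_ge0.
have mh : measurable_fun setT (fun q : (X * X) * R => (h q.1 q.2)%:E).
  by rewrite /h /halfspace; mm; apply: measurable_halfspace; mm.
transitivity (\int[prodP P P']_p \int[leb]_t (h p t)%:E).
  by apply: eq_integral => p _; rewrite abs_dist_layer.
rewrite (integral_swap (prodP P P') leb mh h0); apply: eq_integral => t _.
have m1 : measurable_fun setT (fun y => 1 - halfspace t x y)%R.
  by have h1 := mhalf t x; mm.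
have o0 y : (0 <= 1 - halfspace t x y)%R by rewrite subr_ge0; case/andP: (halfspace01 t x y).
have i0 y : (0 <= halfspace t x y)%R by case/andP: (halfspace01 t x y).
have mp1 (f g : X -> R) : measurable_fun setT f -> measurable_fun setT g ->
    measurable_fun setT (fun p : X * X => (f p.1 * g p.2)%:E).
  by move=> mf mg; mm.
transitivity (\int[prodP P P']_p ((halfspace t x p.1 * (1 - halfspace t x p.2))%:E +
     ((1 - halfspace t x p.1) * halfspace t x p.2)%:E)).
  by apply: eq_integral => p _; rewrite -EFinD /h [X in (_ + X)%R]mulrC.
rewrite integralTD; first last.
- by move=> p; rewrite lee_fin mulr_ge0.
- exact: (mp1 (fun y => 1 - halfspace t x y)%R (halfspace t x)).
- by move=> p; rewrite lee_fin mulr_ge0.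
- exact: (mp1 (halfspace t x) (fun y => 1 - halfspace t x y)%R).
rewrite (integral_prod_mul P P' (mhalf t x) i0 m1 o0).
rewrite (integral_prod_mul P P' m1 o0 (mhalf t x) i0).
have onem (Q : probability X R) : \int[Q]_y (1 - halfspace t x y)%:E = (1 - capP Q x t)%:E.
  by apply: integral_prob_onem => //; exact: capPE.
rewrite !onem ![\int[_]_y (halfspace t x y)%:E]capPE -!EFinM -EFinD.
by rewrite [X in (_ + X)%R]mulrC.
Qed.

(** Here [t] runs over the whole line and [x] may have any length, which makes the quantity
    homogeneous of degree 1 in [x]. *)
Definition capdisc P P' x : \bar R := \int[leb]_t ((capP P x t - capP P' x t) ^+ 2)%:E.

Lemma capdisc_ge0 P P' x : 0 <= capdisc P P' x.
Proof. by apply: integral_ge0 => t _; rewrite lee_fin sqr_ge0. Qed.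

Lemma measurable_capdisc P P' : measurable_fun setT (capdisc P P').
Proof.
apply: (measurable_integral_param leb (f := fun x t => ((capP P x t - capP P' x t) ^+ 2)%:E)).
  by mm; apply: measurable_capP; mm.
by move=> x t; rewrite lee_fin sqr_ge0.
Qed.

Lemma capdisc_scal P P' s x : (0 < s)%R ->
  capdisc P P' (scal s x) = (s ^+ 1)%:E * capdisc P P' x.
Proof.
move=> s0; have si0 : (0 < s^-1)%R by rewrite invr_gt0.
have mc Q : measurable_fun setT (fun t => capP Q x t) by apply: measurable_capP; mm.
have mf : measurable_fun setT (fun t => ((capP P x t - capP P' x t) ^+ 2)%:E).
  by have h1 := mc P; have h2 := mc P'; mm.
have E Q t : capP Q (scal s x) t = capP Q x (s^-1 * t + 0)%R.
  rewrite /capP; congr fine; apply: eq_integral => y _.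
  have -> : (t <= tdot (scal s x) y)%R = (s^-1 * t + 0 <= tdot x y)%R.
    by rewrite tdotZl addr0 ler_pdivrMl.
  by [].
rewrite /capdisc expr1 -[in RHS](invrK s) -(ge0_integral_affine_pos 0 si0 mf); last first.
  by move=> t; rewrite lee_fin sqr_ge0.
by apply: eq_integral => t _; rewrite !E.
Qed.

(** Under the integral it is the identity [2 (a - b)^2 + 2 a (1 - a) + 2 b (1 - b) = 2 (a (1 - b) +
    b (1 - a))]. Subtraction is avoided because the integrals may be infinite. *)
Lemma capdisc_energy P P' x :
  2%:E * capdisc P P' x +
    (\int[prodP P P]_p (`|tdot x p.1 - tdot x p.2|%R)%:E +
     \int[prodP P' P']_p (`|tdot x p.1 - tdot x p.2|%R)%:E) =
  2%:E * \int[prodP P P']_p (`|tdot x p.1 - tdot x p.2|%R)%:E.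
Proof.
have mc Q : measurable_fun setT (fun t => capP Q x t) by apply: measurable_capP; mm.
have m1 := mc P; have m2 := mc P'.
have nn Q Q' t : (0 <= capP Q x t * (1 - capP Q' x t) + capP Q' x t * (1 - capP Q x t))%R.
  have /andP[a0 a1] := capP01 Q x t; have /andP[b0 b1] := capP01 Q' x t.
  by rewrite addr_ge0// mulr_ge0// subr_ge0.
rewrite !integral_dist_cap /capdisc.
rewrite -integralTZl; first last.
- by move=> t; rewrite lee_fin sqr_ge0.
- by mm.
- by [].
rewrite -integralTZl; first last.
- by move=> t; rewrite lee_fin.
- by mm.
- by [].
rewrite -integralTD; first last.
- by move=> t; rewrite lee_fin.
- by mm.
- by move=> t; rewrite lee_fin.
- by mm.
rewrite -integralTD; first last.
- by move=> t; rewrite -EFinD lee_fin addr_ge0.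
- by apply: emeasurable_funD; mm.
- by move=> t; rewrite -EFinM lee_fin mulr_ge0// sqr_ge0.
- by mm.
by apply: eq_integral => t _ /=; rewrite -!EFinD -!EFinM; congr EFin; ring.
Qed.

Definition dist y z : R := Num.sqrt (nsq (sub y z)).

Lemma measurable_sqrtR d (T : measurableType d) (f : T -> R) :
  measurable_fun setT f -> measurable_fun setT (fun t => Num.sqrt (f t)).
Proof.
move=> mf; have ms : measurable_fun setT (fun a : R => Num.sqrt a).
  by apply: continuous_measurable_fun; exact: sqrt_continuous.
exact: (measurableT_comp ms).
Qed.

Lemma measurable_dist : measurable_fun setT (fun p : X * X => dist p.1 p.2).
Proof. by apply: measurable_sqrtR; mm. Qed.

Definition distE P P' : \bar R := \int[prodP P P']_p (dist p.1 p.2)%:E.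

Lemma dist_ge0 y z : (0 <= dist y z)%R. Proof. exact: sqrtr_ge0. Qed.

Lemma distE_ge0 P P' : 0 <= distE P P'.
Proof. by apply: integral_ge0 => p _; rewrite lee_fin dist_ge0. Qed.

Lemma distE_fin P P' : \int[P]_x (nsq x)%:E < +oo -> \int[P']_x (nsq x)%:E < +oo ->
  distE P P' \is a fin_num.
Proof.
move=> h1 h2; rewrite ge0_fin_numE ?distE_ge0//.
pose o := [tuple 0%R | i < n] : X.
have mn : measurable_fun setT (fun x : X => nsq x) by mm.
have one0 (x : X) : (0 <= (cst 1%R : X -> R) x)%R by [].
(* From [|y - z| <= 1 + |y - z|^2 <= 1 + 2 |y|^2 + 2 |z|^2]; the constant factors put both summands
   in the product form of [integral_prod_mul]. *)
apply: (@le_lt_trans _ _ (\int[prodP P P']_p ((1 + 2 * nsq p.1) * cst 1%R p.2)%:E +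
                     \int[prodP P P']_p (cst 1%R p.1 * (2 * nsq p.2))%:E)).
  rewrite -integralTD; first last.
  - by move=> p; rewrite lee_fin !mulr_ge0// nsq_ge0.
  - by mm.
  - by move=> p; rewrite lee_fin mulr_ge0// addr_ge0// mulr_ge0// nsq_ge0.
  - by mm.
  apply: le_integralT.
  - by apply/measurable_EFinP; exact: measurable_dist.
  - by move=> p; rewrite lee_fin dist_ge0.
  - by apply: emeasurable_funD; mm.
  move=> -[y z] /=; rewrite -EFinD lee_fin mulr1 mul1r.
  have h := nsq_sub_le y o z.
  have nso (w : X) : nsq (sub w o) = nsq w.
    by congr nsq; apply: eq_from_tnth => i; rewrite !tnth_mktuple subr0.
  have nos (w : X) : nsq (sub o w) = nsq w.
    by rewrite /nsq /tdot; apply: eq_bigr => i _; rewrite !tnth_mktuple sub0r mulrNN.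
  rewrite nso nos in h; apply: (@le_trans _ _ (1 + nsq (sub y z))%R); last by lra.
  rewrite /dist -{2}(sqr_sqrtr (nsq_ge0 (sub y z))).
  have := sqr_ge0 (Num.sqrt (nsq (sub y z)) - 1)%R; rewrite sqrrB.
  by have := sqrtr_ge0 (nsq (sub y z)); nra.
have fin (Q : probability X R) : \int[Q]_x (nsq x)%:E < +oo ->
    exists m : R, (0 <= m)%R /\ \int[Q]_x (nsq x)%:E = m%:E.
  have : 0 <= \int[Q]_x (nsq x)%:E by apply: integral_ge0 => x _; rewrite lee_fin nsq_ge0.
  by case: (\int[Q]_x _) => [m| |]// m0 _; exists m.
have [m1 [m10 E1]] := fin _ h1; have [m2 [m20 E2]] := fin _ h2.
have two m (Q : probability X R) : (0 <= m)%R -> \int[Q]_x (nsq x)%:E = m%:E ->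
    \int[Q]_x (2 * nsq x)%:E = (2 * m)%:E.
  move=> m0 E; rewrite EFinM -E -integralTZl//.
    by mm.
  by move=> x; rewrite lee_fin nsq_ge0.
have mo : measurable_fun setT (cst 1%R : X -> R) by exact: measurable_cst.
have mf1 : measurable_fun setT (fun y : X => 1 + 2 * nsq y)%R by mm.
have f10 (y : X) : (0 <= 1 + 2 * nsq y)%R by rewrite addr_ge0// mulr_ge0// nsq_ge0.
have mf2 : measurable_fun setT (fun y : X => 2 * nsq y)%R by mm.
have f20 (y : X) : (0 <= 2 * nsq y)%R by rewrite mulr_ge0// nsq_ge0.
rewrite (integral_prod_mul P P' mf1 f10 mo one0) (integral_prod_mul P P' mo one0 mf2 f20).
under eq_integral do rewrite EFinD.
rewrite integralTD; first last.
- by move=> y; rewrite lee_fin mulr_ge0// nsq_ge0.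
- by mm.
- by [].
- by mm.
rewrite (two m1)// (two m2)// /cst !integral_prob_cst.
by rewrite mule1 mul1e -!EFinD ltry.
Qed.

End energy.

(** * Gaussian averaging and positive definiteness *)

Section gauss_energy.
Context {R : realType} {n : nat}.
Local Notation leb := (@lebesgue_measure R).
Local Notation X := (n.-tuple R).
Implicit Types (x y z : X) (P : probability X R).
Local Open Scope ereal_scope.

Lemma gauss_dist_energy : exists c : R, (0 < c)%R /\ forall P P',
  \int[nu n]_x ((expR (- nsq x))%:E *
     \int[prodP P P']_p (`|tdot x p.1 - tdot x p.2|%R)%:E) = c%:E * distE P P'.
Proof.
have [m [m0 mE]] := @abs_moment_gauss R.
have spi : (0 < Num.sqrt (pi : R))%R by rewrite sqrtr_gt0 pi_gt0.
exists (Num.sqrt pi ^+ n / Num.sqrt pi * m)%R; split.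
  by rewrite mulr_gt0// divr_gt0// exprn_gt0.
move=> P P'.
pose F x (p : X * X) : \bar R := (expR (- nsq x))%:E * (`|tdot x p.1 - tdot x p.2|%R)%:E.
have F0 x p : 0 <= F x p by rewrite /F; pos.
have mF : measurable_fun setT (fun q : X * (X * X) => F q.1 q.2) by rewrite /F; mm.
transitivity (\int[nu n]_x \int[prodP P P']_p F x p).
  apply: eq_integral => x _; rewrite -integralTZl.
  - by [].
  - by pos.
  - by mm.
  - by move=> p; rewrite lee_fin.
rewrite (integral_swap (nu n) (prodP P P') mF F0) /distE -integralTZl; first last.
- by move=> p; rewrite lee_fin dist_ge0.
- by apply/measurable_EFinP; exact: measurable_dist.
- by rewrite ltW// mulr_gt0// divr_gt0// exprn_gt0.
apply: eq_integral => p _; rewrite /F.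
have mh : measurable_fun setT (fun t : R => (`|t|%R)%:E : \bar R) by mm.
have h0 (t : R) : 0 <= (`|t|%R)%:E by rewrite lee_fin.
transitivity (\int[nu n]_x ((expR (- nsq x))%:E * (`|tdot x (sub p.1 p.2)|%R)%:E)).
  by apply: eq_integral => x _; rewrite tdotBr.
rewrite (integral_gauss_marginal (sub p.1 p.2) mh h0) mE ?sqrtr_ge0//.
by rewrite -!EFinM mulrA.
Qed.

Definition gaussE P P' (t : R) : R :=
  fine (\int[prodP P P']_p (expR (- (t ^+ 4 * nsq (sub p.1 p.2))))%:E).

Let t4_ge0 (t : R) : (0 <= t ^+ 4)%R.
Proof. exact: exprn_even_ge0. Qed.

Let gauss01 (t : R) y z : (0 <= expR (- (t ^+ 4 * nsq (sub y z))) <= 1)%R.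
Proof. by rewrite expR_ge0 -expR0 ler_expR oppr_le0 mulr_ge0 ?nsq_ge0. Qed.

Lemma gaussE_ex P P' t : (0 <= gaussE P P' t <= 1)%R /\
  \int[prodP P P']_p (expR (- (t ^+ 4 * nsq (sub p.1 p.2))))%:E = (gaussE P P' t)%:E.
Proof.
have mf : measurable_fun setT (fun p : X * X => expR (- (t ^+ 4 * nsq (sub p.1 p.2)))) by mm.
have [s [s01 E]] := integral_prob_fine (prodP P P') mf (fun p => gauss01 t p.1 p.2).
by rewrite /gaussE E.
Qed.

Lemma gaussE01 P P' t : (0 <= gaussE P P' t <= 1)%R.
Proof. by have [] := gaussE_ex P P' t. Qed.

Lemma gaussEE P P' t :
  \int[prodP P P']_p (expR (- (t ^+ 4 * nsq (sub p.1 p.2))))%:E = (gaussE P P' t)%:E.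
Proof. by have [] := gaussE_ex P P' t. Qed.

Lemma measurable_gaussE P P' : measurable_fun setT (gaussE P P').
Proof.
apply/measurable_EFinP.
rewrite (_ : EFin \o _ = fun t =>
    \int[prodP P P']_p (expR (- (t ^+ 4 * nsq (sub p.1 p.2))))%:E); last first.
  by apply/funext => t /=; rewrite gaussEE.
apply: (measurable_integral_param (prodP P P') (f := fun (t : R) (p : X * X) =>
  (expR (- (t ^+ 4 * nsq (sub p.1 p.2))))%:E)).
  by mm.
by move=> t p; pos.
Qed.

(** The parallelogram law around the midpoint [(y + z) / 2], which is expressed through [sub] and
    [scal]. *)
Lemma nsq_midpoint (u y z : X) :
  (2 * nsq (sub u y) + 2 * nsq (sub u z) =
   4 * nsq (sub u (sub (scal 2^-1 y) (scal (- 2^-1) z))) + nsq (sub y z))%R.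
Proof.
rewrite /nsq /tdot !mulr_sumr -!big_split /=; apply: eq_bigr => i _.
by rewrite !tnth_mktuple; field.
Qed.

(* The Gaussian kernel is, up to a constant, the integral over [u] of a product of two Gaussians
   centred at [u], hence positive definite; weighted AM-GM under the integral. *)
Lemma gaussE_posdef P P' t (a : R) : (0 < a)%R ->
  (2 * gaussE P P' t <= a * gaussE P P t + a^-1 * gaussE P' P' t)%R.
Proof.
move=> a0.
(* At [t = 0] the kernel is constantly 1 and has no Gaussian factorization; the claim reduces to
   [2 <= a + 1 / a]. *)
have [->|t0] := eqVneq t 0%R.
  have E Q Q' : gaussE Q Q' 0 = 1%R.
    rewrite /gaussE; under eq_integral do rewrite expr0n/= mul0r oppr0 expR0.
    by rewrite integral_prob_cst.
  rewrite !E !mulr1; rewrite -(ler_pM2l a0) [X in (_ <= X)%R]mulrDr mulfV ?gt_eqF//.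
  by have := sqr_ge0 (a - 1)%R; nra.
pose b : R := (t ^+ 4)%R.
have b0 : (0 < b)%R by rewrite lt_neqAle t4_ge0 eq_sym expf_neq0.
(* By the midpoint identity two Gaussians of rate [2 b] around [u] multiply to [exp(-b |y - z|^2)]
   times a Gaussian in [u] of rate [4 b], whose integral is [K]. *)
pose K : R := (Num.sqrt (pi / (4 * b)) ^+ n)%R.
have K0 : (0 < K)%R by rewrite exprn_gt0// sqrtr_gt0 divr_gt0 ?pi_gt0// mulr_gt0.
pose k (u y : X) : R := expR (- (2 * b * nsq (sub u y))).
have k01 u y : (0 <= k u y <= 1)%R.
  by rewrite /k expR_ge0 -expR0 ler_expR oppr_le0 mulr_ge0 ?nsq_ge0// mulr_ge0// ltW.
have mk u : measurable_fun setT (k u) by rewrite /k; mm.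
pose g (Q : probability X R) u : R := fine (\int[Q]_y (k u y)%:E).
have gE Q u : (0 <= g Q u)%R /\ \int[Q]_y (k u y)%:E = (g Q u)%:E.
  have [s [/andP[s0 _] E]] := integral_prob_fine Q (mk u) (k01 u).
  by rewrite /g E.
have mg (Q : probability X R) : measurable_fun setT (g Q).
  apply/measurable_EFinP; rewrite (_ : EFin \o _ = fun u => \int[Q]_y (k u y)%:E); last first.
    by apply/funext => u /=; rewrite (gE Q u).2.
  apply: (measurable_integral_param Q (f := fun u y => (k u y)%:E)); first by rewrite /k; mm.
  by move=> u y; rewrite /k; pos.
have main (Q Q' : probability X R) : (K * gaussE Q Q' t)%:E = \int[nu n]_u (g Q u * g Q' u)%:E.
  rewrite EFinM -gaussEE -integralTZl; first last.
  - by pos.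
  - by mm.
  - exact: ltW.
  have mkk : measurable_fun setT (fun q : (X * X) * X => (k q.2 q.1.1 * k q.2 q.1.2)%:E).
    by rewrite /k; mm.
  transitivity (\int[prodP Q Q']_p \int[nu n]_u (k u p.1 * k u p.2)%:E).
    apply: eq_integral => -[y z] _ /=.
    pose w := sub (scal 2^-1 y) (scal (- 2^-1) z).
    have b4 : (0 < 4 * b)%R by rewrite mulr_gt0.
    rewrite -(integral_nu_gauss w b4) -integralTZr; first last.
    - by pos.
    - by mm.
    - by pos.
    apply: eq_integral => u _; rewrite -EFinM /k -!expRD.
    congr (expR _)%:E; have := nsq_midpoint u y z; rewrite -/w -/b.
    set A := nsq _; set B := nsq _; set D := nsq _; set E := nsq _ => H.
    have -> : E = (2 * A + 2 * B - 4 * D)%R by rewrite H addrC addKr.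
    by rewrite /b; ring.
  rewrite (integral_swap (prodP Q Q') (nu n) (f := fun p u => (k u p.1 * k u p.2)%:E) mkk); last first.
    by move=> p u; rewrite lee_fin mulr_ge0// /k expR_ge0.
  apply: eq_integral => u _.
  have ku0 y : (0 <= k u y)%R by rewrite /k expR_ge0.
  by rewrite (integral_prod_mul Q Q' (mk u) ku0 (mk u) ku0) (gE Q u).2 (gE Q' u).2 EFinM.
have g0 Q u : (0 <= g Q u)%R by exact: (gE Q u).1.
have mgg Q Q' : measurable_fun setT (fun u => (g Q u * g Q' u)%:E).
  by have h1 := mg Q; have h2 := mg Q'; mm.
have gg0 Q Q' u : 0 <= (g Q u * g Q' u)%:E by rewrite lee_fin mulr_ge0.
rewrite -(ler_pM2l K0) -lee_fin.
have -> : (K * (2 * gaussE P P' t))%:E = 2%:E * \int[nu n]_u (g P u * g P' u)%:E.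
  by rewrite -main -EFinM; congr EFin; ring.
have -> : (K * (a * gaussE P P t + a^-1 * gaussE P' P' t))%:E =
    a%:E * \int[nu n]_u (g P u * g P u)%:E + (a^-1)%:E * \int[nu n]_u (g P' u * g P' u)%:E.
  by rewrite -!main -!EFinM -EFinD; congr EFin; ring.
have ai0 : (0 <= a^-1)%R by rewrite invr_ge0 ltW.
rewrite -(integralTZl _ (ler0n R 2) (mgg _ _) (gg0 _ _)).
rewrite -(integralTZl _ (ltW a0) (mgg _ _) (gg0 _ _)) -(integralTZl _ ai0 (mgg _ _) (gg0 _ _)).
rewrite -integralTD; first last.
- by move=> u; rewrite mule_ge0// lee_fin.
- by apply: emeasurable_funM; [exact: measurable_cst|exact: mgg].
- by move=> u; rewrite mule_ge0// lee_fin ltW.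
- by apply: emeasurable_funM; [exact: measurable_cst|exact: mgg].
apply: le_integralT.
- by apply: emeasurable_funM; [exact: measurable_cst|exact: mgg].
- by move=> u; rewrite mule_ge0.
- by apply: emeasurable_funD; apply: emeasurable_funM; try exact: measurable_cst; exact: mgg.
move=> u; rewrite -!EFinM -EFinD lee_fin -(ler_pM2l a0) [X in (_ <= X)%R]mulrDr mulVKf ?gt_eqF//.
by have := sqr_ge0 (a * g P u - g P' u)%R; nra.
Qed.

Lemma mule_energy (e : R) (a b c d : \bar R) : (0 <= e)%R -> 0 <= a -> 0 <= b -> 0 <= c ->
  2%:E * a + (b + c) = 2%:E * d ->
  2%:E * (e%:E * a) + (e%:E * b + e%:E * c) = 2%:E * (e%:E * d).
Proof.
move=> e0 a0 b0 c0 H.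
have a2 : 0 <= 2%:E * a by rewrite mule_ge0.
by rewrite muleCA -(ge0_muleDr _ b0 c0) -(ge0_muleDr _ a2 (adde_ge0 b0 c0)) H muleCA.
Qed.

(** The Gaussian average and the [t]-integral obey the same linear relation with the three distance
    energies, up to the constants [c0] and [c1]. Bounded second moments make these energies finite,
    so they can be eliminated. The finiteness in the conclusion is what [homog_gauss_le]
    requires. *)
Lemma gauss_capdisc_energy : exists C : R, (0 < C)%R /\ forall P P',
  \int[P]_x (nsq x)%:E < +oo -> \int[P']_x (nsq x)%:E < +oo ->
  \int[nu n]_x ((expR (- nsq x))%:E * capdisc P P' x) < +oo /\
  \int[leb]_t ((`|t|^-1 ^+ 3)%:E *
     (gaussE P P t + gaussE P' P' t - 2 * gaussE P P' t)%:E) =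
  C%:E * \int[nu n]_x ((expR (- nsq x))%:E * capdisc P P' x).
Proof.
have [c0 [c00 H0]] := gauss_dist_energy.
have [c1 [c10 H1]] := @subordination R.
exists (2 * c1 / c0)%R; split; first by rewrite divr_gt0// mulr_gt0.
move=> P P' hP hP'.
set J := \int[nu n]_x _.
have me : measurable_fun setT (fun x : X => (expR (- nsq x))%:E) by mm.
have mD (Q Q' : probability X R) :
    measurable_fun setT (fun x => \int[prodP Q Q']_p (`|tdot x p.1 - tdot x p.2|%R)%:E).
  apply: (measurable_integral_param (prodP Q Q') (f := fun (x : X) (p : X * X) =>
    (`|tdot x p.1 - tdot x p.2|%R)%:E)).
    by mm.
  by move=> x p; rewrite lee_fin.
have D0 (Q Q' : probability X R) x : 0 <= \int[prodP Q Q']_p (`|tdot x p.1 - tdot x p.2|%R)%:E.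
  by apply: integral_ge0 => p _; rewrite lee_fin.
have e0 x : 0 <= (expR (- nsq x))%:E by pos.
have meD (Q Q' : probability X R) := emeasurable_funM me (mD Q Q').
have eD0 (Q Q' : probability X R) x := mule_ge0 (e0 x) (D0 Q Q' x).
have mc := emeasurable_funM me (measurable_capdisc P P').
have ec0 x := mule_ge0 (e0 x) (capdisc_ge0 P P' x).
have HJ : 2%:E * J + (c0%:E * distE P P + c0%:E * distE P' P') = 2%:E * (c0%:E * distE P P').
  rewrite -!H0 /J.
  rewrite -(integralTZl _ (ler0n R 2) (meD P P') (eD0 P P')).
  rewrite -(integralTZl _ (ler0n R 2) mc ec0).
  rewrite -(integralTD _ (meD P P) (eD0 P P) (meD P' P') (eD0 P' P')).
  rewrite -integralTD; first last.
  - by move=> x; rewrite adde_ge0// eD0.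
  - by apply: emeasurable_funD; exact: meD.
  - by move=> x; rewrite mule_ge0// ec0.
  - by apply: emeasurable_funM; [exact: measurable_cst|exact: mc].
  apply: eq_integral => x _ /=.
  exact: (mule_energy (expR_ge0 _) (capdisc_ge0 _ _ _) (D0 _ _ _) (D0 _ _ _) (capdisc_energy _ _ _)).
have f11 := distE_fin hP hP; have f22 := distE_fin hP' hP'; have f12 := distE_fin hP hP'.
have H1' Q Q' : c1%:E * distE Q Q' = \int[leb]_t ((`|t|^-1 ^+ 3)%:E * (1 - gaussE Q Q' t)%:E).
  pose F (p : X * X) (t : R) : \bar R :=
    (`|t|^-1 ^+ 3)%:E * (1 - expR (- (t ^+ 4 * nsq (sub p.1 p.2))))%:E.
  have w0 (t : R) : (0 <= `|t|^-1 ^+ 3)%R by rewrite exprn_ge0// invr_ge0.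
  have o0 (t : R) (p : X * X) : (0 <= 1 - expR (- (t ^+ 4 * nsq (sub p.1 p.2))))%R.
    by rewrite subr_ge0; case/andP: (gauss01 t p.1 p.2).
  have F0 p t : 0 <= F p t by rewrite /F mule_ge0// lee_fin.
  have mw := @measurable_normV3 R.
  have mF : measurable_fun setT (fun q => F q.1 q.2).
    rewrite /F; apply: emeasurable_funM; last by mm.
    by apply/measurable_EFinP; exact: (measurableT_comp mw measurable_snd).
  transitivity (\int[prodP Q Q']_p \int[leb]_t F p t).
    rewrite /distE -integralTZl; first last.
    - by move=> p; rewrite lee_fin dist_ge0.
    - by apply/measurable_EFinP; exact: measurable_dist.
    - exact: ltW.
    apply: eq_integral => p _.
    rewrite -EFinM -(H1 _ (dist_ge0 p.1 p.2)); apply: eq_integral => t _.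
    by rewrite /F /dist sqr_sqrtr ?nsq_ge0.
  rewrite (integral_swap (prodP Q Q') leb mF F0); apply: eq_integral => t _.
  rewrite /F integralTZl; first last.
  - by move=> p; rewrite lee_fin o0.
  - by mm.
  - exact: w0.
  apply: (congr1 (mule _)).
  apply: (integral_prob_onem (P := prodP Q Q') _ (fun p => gauss01 t p.1 p.2)).
    by mm.
  exact: gaussEE.
set I := \int[leb]_t _.
have w0 (t : R) : (0 <= `|t|^-1 ^+ 3)%R by rewrite exprn_ge0// invr_ge0.
have mw := @measurable_normV3 R.
have mg (Q Q' : probability X R) := measurable_gaussE Q Q'.
have g1 (Q Q' : probability X R) t : (0 <= 1 - gaussE Q Q' t)%R.
  by rewrite subr_ge0; case/andP: (gaussE01 Q Q' t).
have E0 t : (0 <= gaussE P P t + gaussE P' P' t - 2 * gaussE P P' t)%R.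
  by have := gaussE_posdef P P' t ltr01; rewrite invr1 !mul1r subr_ge0.
have m1 (Q Q' : probability X R) :
    measurable_fun setT (fun t : R => (`|t|^-1 ^+ 3)%:E * (1 - gaussE Q Q' t)%:E).
  by have h := mg Q Q'; mm.
have n1 (Q Q' : probability X R) t : 0 <= (`|t|^-1 ^+ 3)%:E * (1 - gaussE Q Q' t)%:E.
  by rewrite mule_ge0// lee_fin.
have mI : measurable_fun setT (fun t : R => (`|t|^-1 ^+ 3)%:E *
    (gaussE P P t + gaussE P' P' t - 2 * gaussE P P' t)%:E).
  by have h := mg P P; have h' := mg P' P'; have h'' := mg P P'; mm.
have nI t : 0 <= (`|t|^-1 ^+ 3)%:E *
    (gaussE P P t + gaussE P' P' t - 2 * gaussE P P' t)%:E.
  by rewrite mule_ge0// lee_fin.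
have HI : I + (c1%:E * distE P P + c1%:E * distE P' P') = 2%:E * (c1%:E * distE P P').
  rewrite !H1' -(integralTZl leb (ler0n R 2) (m1 P P') (n1 P P')).
  rewrite -(integralTD leb (m1 P P) (n1 P P) (m1 P' P') (n1 P' P')).
  rewrite /I -integralTD//; first last.
  - by move=> x; rewrite adde_ge0// n1.
  - by apply: emeasurable_funD; exact: m1.
  apply: eq_integral => t _ /=.
  by rewrite -!EFinM -!EFinD; congr EFin; ring.
have J0 : 0 <= J by apply: integral_ge0 => x _; exact: ec0.
have I0 : 0 <= I by apply: integral_ge0 => x _; exact: nI.
move: HI HJ; rewrite -(fineK f11) -(fineK f22) -(fineK f12).
clearbody I J.
case: I I0 => [i| |]// i0; case: J J0 => [j| |]// j0.
- set r11 := fine _; set r22 := fine _; set r12 := fine _.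
  clearbody r11 r22 r12; rewrite -!EFinM -!EFinD => -[HI] -[HJ]; split; first exact: ltry.
  congr EFin.
  have : (c0 * i = 2 * c1 * j)%R.
    have -> : (i = 2 * (c1 * r12) - (c1 * r11 + c1 * r22))%R by rewrite -HI addrK.
    have Hj : (2 * j = 2 * (c0 * r12) - (c0 * r11 + c0 * r22))%R by rewrite -HJ addrK.
    have -> : (2 * c1 * j = c1 * (2 * j))%R by ring.
    by rewrite Hj; ring.
  move=> H; have -> : (i = c0^-1 * (c0 * i))%R by rewrite mulrA mulVf ?mul1r// gt_eqF.
  by rewrite H; ring.
- by move=> _; rewrite gt0_muley.
Qed.

End gauss_energy.

(** * From the sphere average to the ball average *)

Section sphere_discrepancy.
Context {R : realType}.
Local Notation leb := (@lebesgue_measure R).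
Local Open Scope ereal_scope.

(* [P] is carried by the unit ball; a probability does not see the values of an integrand outside
   it. *)
Definition in_ball n (P : probability (n.-tuple R) R) : Prop :=
  forall f g : n.-tuple R -> \bar R, (forall x, 0 <= f x) -> measurable_fun setT f ->
    (forall x, 0 <= g x) -> measurable_fun setT g ->
    (forall x, (nsq x <= 1)%R -> f x = g x) -> \int[P]_x f x = \int[P]_x g x.

Lemma tdot_le1 n (x y : n.-tuple R) : (nsq x <= 1)%R -> (nsq y <= 1)%R ->
  (-1 <= tdot x y <= 1)%R.
Proof.
move=> x1 y1; have := nsq_ge0 (sub x y); have := nsq_ge0 (sub (scal (-1) x) y).
by rewrite !nsqB nsqZ tdotZl => h1 h2; apply/andP; split; nra.
Qed.

Lemma in_ball_capP n (P : probability (n.-tuple R) R) x t : in_ball P -> (nsq x <= 1)%R ->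
  ((t < -1)%R -> capP P x t = 1%R) /\ ((1 < t)%R -> capP P x t = 0%R).
Proof.
move=> H x1.
have mh : measurable_fun setT (fun y : n.-tuple R => ((t <= tdot x y)%R%:R)%:E : \bar R).
  by apply/measurable_EFinP; apply: measurable_halfspace; mm.
have h0 (y : n.-tuple R) : 0 <= ((t <= tdot x y)%R%:R)%:E :> \bar R by rewrite lee_fin ler0n.
have key (r : R) : (0 <= r)%R -> (forall y, (nsq y <= 1)%R -> ((t <= tdot x y)%R%:R = r)%R) ->
    capP P x t = r.
  move=> r0 E; apply: EFin_inj; rewrite -capPE -(integral_prob_cst P r); apply: H => //.
  by move=> y y1; rewrite E.
split=> t1; apply: key => // y y1; have /andP[l u] := tdot_le1 x1 y1.
  by rewrite (le_trans (ltW t1) l).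
by rewrite leNgt (le_lt_trans u t1).
Qed.

Lemma in_ball_nsq n (P : probability (n.-tuple R) R) : in_ball P ->
  \int[P]_x (nsq x)%:E < +oo.
Proof.
move=> H; have mn : measurable_fun setT (fun x : n.-tuple R => nsq x) by mm.
have mi : measurable_fun setT (fun x : n.-tuple R => inball x) by apply: measurable_inball; mm.
rewrite (H _ (fun x => (nsq x * inball x)%:E)).
- apply: (@le_lt_trans _ _ 1%:E); last exact: ltry.
  apply: integral_prob_le.
  + by mm.
  + by move=> x; rewrite lee_fin mulr_ge0 ?nsq_ge0 ?inball_ge0.
  + move=> x; rewrite lee_fin /inball.
    by have [h|h] := leP (nsq x) 1%R; rewrite ?mulr1 ?mulr0 ?ler01.
- by move=> x; rewrite lee_fin nsq_ge0.
- by mm.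
- by move=> x; rewrite lee_fin mulr_ge0 ?nsq_ge0 ?inball_ge0.
- by mm.
- by move=> x x1; rewrite /inball x1 mulr1.
Qed.

Lemma in_ball_sphereP n : in_ball (@sphereP R n).
Proof.
move=> f g f0 mf g0 mg fg; rewrite !integral_sphereP//; congr (_ * _).
by apply: eq_integral => x _; rewrite fg// nsq_unit_le.
Qed.

Definition disc2 n (P : probability (n.-tuple R) R) : \bar R :=
  \int[leb]_(t in [set` `[-1, 1]%R]) \int[sphereP]_x ((capP P x t - capP sphereP x t) ^+ 2)%:E.

(** By homogeneity [capdisc] at [x] is [|x|] times its value at [unit x], and [|x| <= 1] on the
    ball; the origin is fixed by [unit]. *)
Lemma capdisc_unit n (P Q : probability (n.-tuple R) R) x :
  (inball x)%:E * capdisc P Q x <= (inball x)%:E * capdisc P Q (unit x).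
Proof.
suff H : (nsq x <= 1)%R -> capdisc P Q x <= capdisc P Q (unit x).
  move: (capdisc P Q x) (capdisc P Q (unit x)) H => a b H.
  rewrite /inball; have [x1|_] := leP (nsq x) 1%R; last by rewrite !mul0e.
  by rewrite !mul1e H.
move=> x1; have := nsq_ge0 x; rewrite le_eqVlt => /predU1P[x0|x0].
  suff -> : unit x = x by [].
  have z i : tnth x i = 0%R.
    have : (\sum_i tnth x i * tnth x i == 0)%R by rewrite eq_sym; apply/eqP.
    rewrite psumr_eq0 => [/allP/(_ i)|j _]; last by rewrite -expr2 sqr_ge0.
    by rewrite mem_index_enum mulf_eq0 orbb => /(_ isT)/eqP.
  by apply: eq_from_tnth => i; rewrite tnth_mktuple z mulr0.
rewrite -{1}(scal_unit x0) capdisc_scal ?sqrtr_gt0// expr1.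
rewrite -[leRHS]mul1e; apply: lee_wpmul2r; first exact: capdisc_ge0.
by rewrite lee_fin -[leRHS]sqrtr1 ler_sqrt.
Qed.

(** Inserting [inball x] does not change the sphere average, and where it is nonzero both cap
    functions agree for [t] outside [[-1, 1]]. The range of [t] may thus be extended to the line,
    which yields [capdisc] after an exchange of integrals. *)
Lemma capdisc_disc2 n (P : probability (n.-tuple R) R) : in_ball P ->
  ((@ballV R n)^-1)%:E * \int[nu n]_x ((inball x)%:E * capdisc P sphereP x) <= disc2 P.
Proof.
move=> HP; have HS := @in_ball_sphereP n.
have mi : measurable_fun setT (fun x : n.-tuple R => inball x) by apply: measurable_inball; mm.
have mP := measurable_capP P; have mS := measurable_capP (@sphereP R n).
pose A : set R := [set` `[-1, 1]%R].
pose h (t : R) (x : n.-tuple R) : \bar R := ((capP P x t - capP sphereP x t) ^+ 2 * inball x)%:E.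
have h0 t x : 0 <= h t x by rewrite lee_fin mulr_ge0 ?sqr_ge0 ?inball_ge0.
have mh : measurable_fun setT (fun q : R * n.-tuple R => h q.1 q.2).
  by rewrite /h; mm; [exact: mP|exact: mS].
have E : disc2 P = \int[leb]_t \int[sphereP]_x h t x.
  rewrite /disc2 integral_mkcond; apply: eq_integral => t _; rewrite patchE.
  have mht : measurable_fun setT (h t) by exact: (measurableT_comp mh (pair1_measurable t)).
  case: ifPn => [_|].
    apply: HS => //.
    - by move=> x; rewrite lee_fin sqr_ge0.
    - by mm; [apply: mP|apply: mS]; mm.
    - by move=> x x1; rewrite /h /inball x1 mulr1.
  rewrite notin_setE /= in_itv /= => tA.
  rewrite (_ : \int[_]_x _ = \int[@sphereP R n]_x 0); first by rewrite integral0.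
  apply: eq_integral => x _; rewrite /h /inball; case: leP => x1; last by rewrite mulr0.
  have [a1 a2] := in_ball_capP t HP x1; have [b1 b2] := in_ball_capP t HS x1.
  have [t1|t1] := ltP t (-1)%R; first by rewrite a1// b1// subrr expr0n/= mul0r.
  have [t2|t2] := ltP 1%R t; first by rewrite a2// b2// subrr expr0n/= mul0r.
  by exfalso; apply: tA; rewrite t1 t2.
rewrite E (integral_swap leb sphereP mh h0).
have mc := measurable_capdisc P sphereP.
have E2 x : \int[leb]_t h t x = capdisc P sphereP x * (inball x)%:E.
  rewrite -integralTZr.
  - by apply: eq_integral => t _; rewrite /h EFinM.
  - by rewrite lee_fin inball_ge0.
  - by mm; [apply: mP|apply: mS]; mm.
  - by move=> t; rewrite lee_fin sqr_ge0.
rewrite (_ : \int[sphereP]_y _ = \int[sphereP]_x (capdisc P sphereP x * (inball x)%:E)); last first.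
  by apply: eq_integral => x _; exact: E2.
rewrite integral_sphereP; first last.
- by mm.
- by move=> x; rewrite mule_ge0 ?capdisc_ge0// lee_fin inball_ge0.
apply: lee_wpmul2l; first by rewrite lee_fin invr_ge0 ltW// ballV_gt0.
apply: le_integralT.
- by mm.
- by move=> x; rewrite mule_ge0 ?capdisc_ge0// lee_fin inball_ge0.
- apply: emeasurable_funM; first by mm.
  by apply: emeasurable_funM; [exact: (measurableT_comp mc measurable_unit)|
    apply/measurable_EFinP; exact: (measurable_inball measurable_unit)].
- move=> x; rewrite [X in _ <= _ * (_ * X)](_ : _ = 1) ?mule1; first exact: capdisc_unit.
  by rewrite /inball nsq_unit_le.
Qed.

(** Guards the [fine] in [cap_disc], which would send an infinite value to 0: the integrand is at
    most 1 and [t] runs over a bounded interval. *)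
Lemma disc2_fin n (P : probability (n.-tuple R) R) : disc2 P \is a fin_num.
Proof.
have mP := measurable_capP P; have mS := measurable_capP (@sphereP R n).
have m1 : measurable_fun setT (fun q : R * n.-tuple R => ((capP P q.2 q.1 - capP sphereP q.2 q.1) ^+ 2)%:E).
  by mm; [apply: mP|apply: mS]; mm.
have m2 := measurable_integral_param (@sphereP R n) (f := fun t x =>
  ((capP P x t - capP sphereP x t) ^+ 2)%:E) m1.
have c0 (t : R) (x : n.-tuple R) : 0 <= ((capP P x t - capP sphereP x t) ^+ 2)%:E.
  by rewrite lee_fin sqr_ge0.
have n0 (t : R) : 0 <= \int[@sphereP R n]_x ((capP P x t - capP sphereP x t) ^+ 2)%:E.
  exact: integral_ge0.
rewrite ge0_fin_numE; last by apply: integral_ge0.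
have mA : measurable ([set` `[-1, 1]%R] : set R) by exact: measurable_itv.
apply: (@le_lt_trans _ _ (\int[leb]_(t in [set` `[-1, 1]%R]) (cst 1%:E t))).
  apply: ge0_le_integral => //.
  - by apply: measurable_funTS; apply: m2.
  - move=> t _; apply: integral_prob_le => //.
      exact: (measurableT_comp m1 (pair1_measurable t)).
    move=> x; rewrite lee_fin.
    by have := capP01 P x t; have := capP01 (@sphereP R n) x t; nra.
rewrite integral_cst// mul1e.
suff : leb [set` `[-1, 1]%R] < +oo by [].
by rewrite lebesgue_measure_itv/= lte_fin; case: ifPn => _; rewrite -?EFinD ltry.
Qed.

End sphere_discrepancy.

(** * Lower bound for the discrepancy of a probability *)

Section lower_bound.
Context {R : realType}.
Local Notation leb := (@lebesgue_measure R).
Local Open Scope ereal_scope.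

(* In the variable [u = t^2] this is [u^(d - 1/2)] cut off at [l^2], dominated by the density
   [u^(-2) du] of the subordination formula. The half-integer exponent makes the averaged Gaussian
   decay like [r^(-d - 1/2)], slowly enough to absorb the logarithm, whereas [u^(d - 1/2)] times the
   self-energy [O(u^(-d))] of the sphere is still integrable at 0. *)
Definition weight d (l t : R) : R := ((`|t| <= l)%R%:R * (((t / l) ^+ 2) ^+ d * l^-1 ^+ 3))%R.

Lemma weight_ge0 d l t : (0 < l)%R -> (0 <= weight d l t)%R.
Proof.
move=> l0; rewrite /weight; apply: mulr_ge0; first exact: ler0n.
by apply: mulr_ge0; [rewrite exprn_ge0// sqr_ge0|rewrite exprn_ge0// invr_ge0 ltW].
Qed.

Lemma measurable_weight d l : measurable_fun setT (weight d l).
Proof.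
by rewrite /weight; mm; apply: measurable_natb; apply: measurable_fun_ler; mm.
Qed.

Lemma weight_le d l t : (1 <= d)%N -> (0 < l)%R -> (weight d l t <= `|t|^-1 ^+ 3)%R.
Proof.
move=> d1 l0; rewrite /weight.
have [tl|_] := leP `|t|%R l; last by rewrite mul0r exprn_ge0// invr_ge0.
(* At [t = 0] the right side is 0 by the convention for inverses, and the left side vanishes too
   because [d >= 1]. *)
rewrite mul1r; have [->|t0] := eqVneq t 0%R.
  by rewrite mul0r expr0n/= expr0n eqn0Ngt d1 mul0r exprn_ge0// invr_ge0.
have a0 : (0 < `|t|)%R by rewrite normr_gt0.
rewrite -[leRHS]mul1r; apply: ler_pM.
- by rewrite exprn_ge0// sqr_ge0.
- by rewrite exprn_ge0// invr_ge0 ltW.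
- rewrite exprn_ile1 ?sqr_ge0// -real_normK ?num_real// exprn_ile1//.
  by rewrite normrM normrV ?unitfE ?gt_eqF// (gtr0_norm l0) ler_pdivrMr ?mul1r.
- apply: lerXn2r.
  + by rewrite nnegrE invr_ge0 ltW.
  + by rewrite nnegrE invr_ge0 ltW.
  + by rewrite lef_pV2 ?posrE.
Qed.

(** Keep only [b / 2 <= t <= b] with [b = l q] and [q = (1 + l^2 r)^(-1/2)]. There
    [t^2 r <= b^2 r <= 1], so the Gaussian is at least [exp(-1)], and the weight is at least
    [(q / 2)^(2d) l^-3]; the interval has length [l q / 2]. *)
Lemma weight_gauss_ge d (l r : R) : (0 < l)%R -> (0 <= r)%R ->
  (expR (-1) * 2^-1 ^+ d.*2.+1 * l^-1 ^+ 2 * (Num.sqrt (1 + l ^+ 2 * r))^-1 ^+ d.*2.+1)%:E <=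
  \int[leb]_t (weight d l t * expR (- (t ^+ 4 * r ^+ 2)))%:E.
Proof.
move=> l0 r0; set s := Num.sqrt _; pose q : R := s^-1%R.
have lr0 : (0 <= l ^+ 2 * r)%R by rewrite mulr_ge0 ?sqr_ge0.
have s0 : (0 < s)%R by rewrite sqrtr_gt0 ltr_wpDr.
have s2 : (s ^+ 2 = 1 + l ^+ 2 * r)%R by rewrite sqr_sqrtr// addr_ge0.
have q0 : (0 < q)%R by rewrite invr_gt0.
have q2 : (q ^+ 2 * (1 + l ^+ 2 * r) = 1)%R by rewrite -s2 -exprMn mulVf ?expr1n// gt_eqF.
have q1 : (q <= 1)%R.
  rewrite invf_le1// -sqrtr1 ler_sqrt ?lerDl// addr_ge0//.
pose b := (l * q)%R.
have b0 : (0 < b)%R by rewrite mulr_gt0.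
have ql0 : (0 < (q / 2) ^+ 2)%R by rewrite exprn_gt0// divr_gt0.
pose m : R := (((q / 2) ^+ 2) ^+ d * l^-1 ^+ 3 * expR (-1))%R.
have li0 : (0 <= l^-1)%R by rewrite invr_ge0 ltW.
have m0 : (0 <= m)%R.
  by rewrite mulr_ge0 ?expR_ge0// mulr_ge0// exprn_ge0// ltW.
have -> : (expR (-1) * 2^-1 ^+ d.*2.+1 * l^-1 ^+ 2 * q ^+ d.*2.+1 = m * (b - b / 2))%R.
  rewrite /m /b -exprM mul2n expr_div_n !exprSr.
  have : (2 ^+ d.*2 != 0 :> R)%R by rewrite expf_neq0.
  rewrite exprVn => h; field.
  by rewrite h gt_eqF.
have mw := @measurable_weight d l.
apply: integral_ge_itv.
- by mm.
- by move=> t; rewrite mulr_ge0 ?expR_ge0 ?weight_ge0.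
- exact: m0.
- by lra.
move=> t /andP[tb1 tb2].
have t0 : (0 < t)%R by lra.
have tl : (`|t| <= l)%R by rewrite gtr0_norm// (le_trans tb2)// /b ler_piMr// ltW.
rewrite /m /weight tl mul1r; apply: ler_pM.
- by rewrite mulr_ge0// exprn_ge0// ltW.
- exact: expR_ge0.
- apply: ler_wpM2r; first by rewrite exprn_ge0// invr_ge0 ltW.
  apply: lerXn2r; rewrite ?nnegrE ?sqr_ge0//.
  apply: lerXn2r.
  + by rewrite nnegrE divr_ge0 ?(ltW q0).
  + by rewrite nnegrE divr_ge0 ?(ltW t0) ?(ltW l0).
  + by rewrite ler_pdivlMr//; move: tb1; rewrite /b; lra.
- rewrite ler_expR lerN2.
  have h1 : (t ^+ 2 <= b ^+ 2)%R by apply: lerXn2r => //; rewrite nnegrE ltW.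
  have h2 : (b ^+ 2 * r <= 1)%R.
    by rewrite /b exprMn; have := sqr_ge0 q; lra.
  have h3 : (t ^+ 2 * r <= 1)%R by apply: le_trans h2; exact: ler_wpM2r.
  have -> : (t ^+ 4 * r ^+ 2 = (t ^+ 2 * r) ^+ 2)%R by ring.
  by rewrite exprn_ile1// mulr_ge0// sqr_ge0.
Qed.

Lemma nsq_subC n (x y : n.-tuple R) : nsq (sub x y) = nsq (sub y x).
Proof. by rewrite !nsqB (tdotC y x); ring. Qed.

Lemma gaussE_sphereP d : exists C : R, (0 < C)%R /\ forall t : R, t != 0%R ->
  (gaussE (@sphereP R d.+1) (@sphereP R d.+1) t <= C * (t ^+ 2)^-1 ^+ d)%R.
Proof.
have [C [C0 H]] := @sphere_gauss_le R d; exists C; split => // t t0.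
have t2 : (0 < t ^+ 2)%R by rewrite exprn_even_gt0.
rewrite -lee_fin -gaussEE.
pose f (x y : d.+1.-tuple R) : \bar R := (expR (- (t ^+ 4 * nsq (sub x y))))%:E.
have mf : measurable_fun setT (fun p : d.+1.-tuple R * d.+1.-tuple R => f p.1 p.2) by rewrite /f; mm.
have f0 x y : 0 <= f x y by rewrite /f; pos.
rewrite [leLHS](integral_prodE sphereP sphereP mf f0).
apply: integral_prob_le.
- exact: measurable_integral_param.
- by move=> x; apply: integral_ge0.
- move=> x; apply: le_trans (H (t ^+ 2)%R x t2); rewrite le_eqVlt; apply/orP; left; apply/eqP.
  by apply: eq_integral => y _; rewrite /f nsq_subC -exprM.
Qed.

(** This is [(1 + l^2 r)^(-d - 1/2)], the half-integer power being an odd power of an inverse square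
    root. *)
Definition kern d (l r : R) : R := ((Num.sqrt (1 + l ^+ 2 * r))^-1 ^+ d.*2.+1)%R.

Lemma kern_ge0 d l r : (0 <= kern d l r)%R.
Proof. by rewrite exprn_ge0// invr_ge0 sqrtr_ge0. Qed.

Lemma measurable_kern d T (S : measurableType T) (l : R) (f : S -> R) :
  measurable_fun setT f -> measurable_fun setT (fun x => kern d l (f x)).
Proof.
move=> mf; apply: measurable_funX.
rewrite (_ : (fun x => _) = fun x => ((Num.sqrt (1 + l ^+ 2 * f x)) `^ (-1))%R); last first.
  by apply/funext => x; rewrite powR_inv1// sqrtr_ge0.
apply: (measurableT_comp (@measurable_powR R (-1)%R)).
by apply: measurable_sqrtR; mm.
Qed.

Lemma energy_lower d : (1 <= d)%N -> exists c C : R, [/\ (0 < c)%R, (0 < C)%R &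
  forall P : probability (d.+1.-tuple R) R, in_ball P -> forall l : R, (0 < l)%R ->
  (c * l^-1 ^+ 2)%:E * \int[prodP P P]_p (kern d l (dist p.1 p.2))%:E <=
  C%:E * disc2 P + (C * l^-1 ^+ d.*2.+2)%:E].
Proof.
move=> d1; pose n := d.+1.
have [CE [CE0 HE]] := @gauss_capdisc_energy R n.
have [CH [CH0 HH]] := @homog_gauss_le R n 1.
have [Cs [Cs0 Hs]] := gaussE_sphereP d.
pose V : R := @ballV R n; have V0 : (0 < V)%R by exact: ballV_gt0.
pose c0 : R := (expR (-1) * 2^-1 ^+ d.*2.+1)%R.
have c00 : (0 < c0)%R by rewrite mulr_gt0 ?expR_gt0// exprn_gt0.
have a0 : (0 < CE * CH * V)%R by rewrite !mulr_gt0.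
(* The half comes from the weighted inequality between the energies and [c0] from [weight_gauss_ge];
   the second constant adds the factors in front of [disc2 P] and of the self-energy of the
   sphere. *)
exists (2^-1 * c0)%R, (CE * CH * V + 2 * Cs)%R; split.
- by rewrite mulr_gt0.
- by rewrite addr_gt0// mulr_gt0.
move=> P HP l l0; have HS := @in_ball_sphereP R n.
pose S := @sphereP R n.
have [Jfin IE] := HE P S (in_ball_nsq HP) (in_ball_nsq HS).
set J := \int[nu n]_x _ in Jfin IE.
pose B := \int[nu n]_x ((inball x)%:E * capdisc P S x).
have JB : J <= CH%:E * B.
  apply: HH => //; [exact: capdisc_ge0|exact: measurable_capdisc|].
  by move=> s x s0; exact: capdisc_scal.
have BD : B <= V%:E * disc2 P.
  have := capdisc_disc2 HP; rewrite -/B -/V => h.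
  have : V%:E * ((V^-1)%:E * B) <= V%:E * disc2 P by apply: lee_wpmul2l => //; rewrite lee_fin ltW.
  by rewrite muleA -EFinM mulfV ?gt_eqF// mul1e.
set I := \int[leb]_t _ in IE.
have ID : I <= (CE * CH * V)%:E * disc2 P.
  rewrite IE !EFinM -!muleA; apply: lee_wpmul2l; first by rewrite lee_fin ltW.
  by apply: (le_trans JB); apply: lee_wpmul2l => //; rewrite lee_fin ltW.
have mw := @measurable_weight d l.
have w0 t := weight_ge0 d t l0.
have mg (Q Q' : probability (n.-tuple R) R) := measurable_gaussE Q Q'.
have g0 (Q Q' : probability (n.-tuple R) R) t : (0 <= gaussE Q Q' t)%R.
  by case/andP: (gaussE01 Q Q' t).
pose W := \int[leb]_t (weight d l t * gaussE P P t)%:E.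
pose W2 := \int[leb]_t (weight d l t * gaussE S S t)%:E.
have mv3 := @measurable_normV3 R.
have WI : (2^-1)%:E * W <= I + W2.
  have m11 := mg P P; have m22 := mg S S; have m12 := mg P S.
  have n3 (t : R) : (0 <= `|t|^-1 ^+ 3)%R by rewrite exprn_ge0// invr_ge0.
  have E0 t : (0 <= gaussE P P t + gaussE S S t - 2 * gaussE P S t)%R.
    by have := gaussE_posdef P S t ltr01; rewrite invr1 !mul1r subr_ge0.
  rewrite -integralTZl; first last.
  - by move=> t; rewrite lee_fin mulr_ge0.
  - by mm.
  - by rewrite invr_ge0.
  rewrite /I /W2 -integralTD; first last.
  - by move=> t; rewrite lee_fin mulr_ge0.
  - by mm.
  - by move=> t; rewrite mule_ge0// lee_fin.
  - by mm.
  apply: le_integralT.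
  - by mm.
  - by move=> t; rewrite -EFinM lee_fin mulr_ge0 ?invr_ge0// mulr_ge0.
  - by apply: emeasurable_funD; mm.
  move=> t; rewrite -!EFinM -EFinD lee_fin.
  (* The weight [a = 1/2] leaves half of the energy of [P], at the price of only one further copy of
     that of [S]. *)
  have h1 : (2 * gaussE P S t <= 2^-1 * gaussE P P t + 2 * gaussE S S t)%R.
    by have := @gaussE_posdef R n P S t 2^-1; rewrite invrK; apply; rewrite invr_gt0.
  have h2 := ler_wpM2r (E0 t) (weight_le t d1 l0).
  have := ler_wpM2l (w0 t) h1; move: h2.
  move: (weight d l t) (gaussE P P t) (gaussE S S t) (gaussE P S t) (`|t|^-1 ^+ 3)%R.
  by move=> w a b e v h2 h3; lra.
have li0 : (0 <= l^-1)%R by rewrite invr_ge0 ltW.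
(* For [|t| <= l] the powers of [t] in the weight and in the self-energy bound cancel, leaving the
   constant [Cs l^(-2d - 3)] on an interval of length [2 l]. *)
have W2le : W2 <= (2 * Cs * l^-1 ^+ d.*2.+2)%:E.
  have ll : (- l <= l)%R by lra.
  have mA : measurable ([set` `[- l, l]%R] : set R) by exact: measurable_itv.
  have mi : measurable_fun setT (fun t : R => (\1_([set` `[- l, l]%R] : set R) t)%:E : \bar R).
    by apply/measurable_EFinP; exact: measurable_indic.
  have k0 : (0 <= Cs * l^-1 ^+ d.*2.+3)%R by rewrite mulr_ge0 ?exprn_ge0// ltW.
  have -> : (2 * Cs * l^-1 ^+ d.*2.+2)%:E = (Cs * l^-1 ^+ d.*2.+3)%:E * (l - - l)%:E.
    rewrite -EFinM; congr EFin; rewrite [in RHS]exprS.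
    by field; rewrite gt_eqF.
  rewrite -(integral_indic_itv ll) -integralTZl//.
  apply: le_integralT.
  - by have m22 := mg S S; mm.
  - by move=> t; rewrite lee_fin mulr_ge0.
  - by apply: emeasurable_funM.
  move=> t; rewrite -EFinM lee_fin indicE.
  have -> : (t \in ([set` `[- l, l]%R] : set R)) = (`|t| <= l)%R.
    by apply/idP/idP; rewrite inE /= in_itv/= ler_norml.
  rewrite /weight; have [tl|_] := leP `|t|%R l; last by rewrite !mul0r mulr0.
  rewrite mul1r mulr1; have [->|t0] := eqVneq t 0%R.
    by rewrite mul0r expr0n/= expr0n eqn0Ngt d1 !mul0r.
  have t2 : (t ^+ 2 != 0)%R by rewrite expf_neq0.
  apply: (@le_trans _ _ (((t / l) ^+ 2) ^+ d * l^-1 ^+ 3 * (Cs * (t ^+ 2)^-1 ^+ d))%R).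
    apply: ler_wpM2l; last exact: Hs.
    by apply: mulr_ge0; [rewrite exprn_ge0// sqr_ge0|rewrite exprn_ge0].
  rewrite le_eqVlt; apply/orP; left; apply/eqP.
  have -> : (((t / l) ^+ 2) ^+ d  = (t ^+ 2) ^+ d * l^-1 ^+ d.*2)%R.
    by rewrite -!exprM !mul2n exprMn.
  have e1 : ((t ^+ 2) ^+ d * (t ^+ 2)^-1 ^+ d = 1)%R by rewrite -exprMn mulfV ?expr1n.
  transitivity (Cs * (l^-1 ^+ 3 * l^-1 ^+ d.*2) * ((t ^+ 2) ^+ d * (t ^+ 2)^-1 ^+ d))%R.
    by ring.
  by rewrite e1 mulr1 -exprD.
have Wge : (c0 * l^-1 ^+ 2)%:E * \int[prodP P P]_p (kern d l (dist p.1 p.2))%:E <= W.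
  have md := @measurable_dist R n.
  have mk : measurable_fun setT (fun p : n.-tuple R * n.-tuple R => kern d l (dist p.1 p.2)).
    exact: measurable_kern.
  pose F (t : R) (p : n.-tuple R * n.-tuple R) : \bar R :=
    (weight d l t)%:E * (expR (- (t ^+ 4 * nsq (sub p.1 p.2))))%:E.
  have F0 t p : 0 <= F t p by rewrite /F mule_ge0// lee_fin ?expR_ge0.
  have mF : measurable_fun setT (fun q => F q.1 q.2) by rewrite /F; mm.
  have -> : W = \int[leb]_t \int[prodP P P]_p F t p.
    apply: eq_integral => t _; rewrite EFinM -gaussEE -integralTZl//.
    by mm.
  rewrite (integral_swap leb (prodP P P) mF F0) -integralTZl; first last.
  - by move=> p; rewrite lee_fin kern_ge0.
  - by mm.
  - by rewrite mulr_ge0 ?exprn_ge0// ltW.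
  apply: le_integralT.
  - by mm.
  - by move=> p; rewrite -EFinM lee_fin !mulr_ge0 ?exprn_ge0 ?kern_ge0// ltW.
  - apply: (measurable_integral_param leb (f := fun p t => F t p)) => //.
    exact: (measurableT_comp mF (measurable_fun_pair measurable_snd measurable_fst)).
  move=> p; rewrite -EFinM.
  apply: le_trans (weight_gauss_ge d l0 (dist_ge0 p.1 p.2)) _.
  rewrite le_eqVlt; apply/orP; left; apply/eqP; apply: eq_integral => t _.
  by rewrite /F -EFinM /dist sqr_sqrtr ?nsq_ge0.
apply: (@le_trans _ _ ((2^-1)%:E * W)).
  rewrite -[(2^-1 * c0 * _)%R]mulrA [((2^-1 * (c0 * _))%R)%:E]EFinM -muleA.
  by apply: lee_wpmul2l => //; rewrite lee_fin invr_ge0.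
apply: (le_trans WI); have D0 : 0 <= disc2 P.
  by apply: integral_ge0 => t _; apply: integral_ge0 => x _; rewrite lee_fin sqr_ge0.
apply: leeD.
  apply: (le_trans ID); apply: lee_wpmul2r => //.
  by rewrite lee_fin lerDl mulr_ge0// ltW.
apply: (le_trans W2le); rewrite lee_fin ler_wpM2r ?exprn_ge0//.
by rewrite lerDr ltW.
Qed.

End lower_bound.

(** * The empirical measure of the point set *)

Section empirical_measure.
Context {R : realType} (n N : nat) (z : 'I_N -> n.-tuple R).
Hypothesis N0 : (0 < N)%N.
Local Notation X := (n.-tuple R).
Local Open Scope ereal_scope.

Lemma empirical_ex : exists P : probability X R, forall f : X -> \bar R,
  (forall x, 0 <= f x) -> measurable_fun setT f ->
  \int[P]_x f x = (N%:R^-1)%:E * \sum_(i < N) f (z i).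
Proof.
(* [msum] takes a sequence indexed by the naturals; beyond [N] a point of the set serves as filler
   and does not enter the sum. *)
pose zz k := if insub k is Some i then z i else z (Ordinal N0).
pose m : {measure set X -> \bar R} := msum (fun k => dirac (zz k)) N.
have zzE (i : 'I_N) : zz i = z i by rewrite /zz valK.
have mN : m setT = N%:R%:E.
  rewrite /= /msum; transitivity (\sum_(i < N) (1%:E : \bar R)).
    by apply: eq_bigr => i _; exact: diracT.
  by rewrite sumEFin big_const_ord iter_addr addr0.
exists (mnormalize m (dirac (z (Ordinal N0)))) => f f0 mf.
have V0 : (0 <= N%:R^-1 :> R)%R by rewrite invr_ge0.
transitivity (\int[mscale (NngNum V0) m]_x f x).
  apply: eq_measure_integral => A mA _; rewrite /= /mnormalize.
  rewrite [X in if X then _ else _](_ : _ = false); last first.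
    by rewrite -/(m setT) mN /= orbF; apply/negbTE; rewrite eqe pnatr_eq0 -lt0n.
  by rewrite -/(m setT) mN /= /mscale /= muleC.
rewrite ge0_integral_mscale//=; congr (_ * _).
rewrite ge0_integral_measure_sum//; apply: eq_bigr => i _.
by rewrite integral_dirac// diracT mul1e zzE.
Qed.

Definition empirical : probability X R := projT1 (cid empirical_ex).

Lemma integral_empirical (f : X -> \bar R) :
  (forall x, 0 <= f x) -> measurable_fun setT f ->
  \int[empirical]_x f x = (N%:R^-1)%:E * \sum_(i < N) f (z i).
Proof. by rewrite /empirical; case: cid => P /= H; exact: H. Qed.

Lemma in_ball_empirical : (forall i, (nsq (z i) <= 1)%R) -> in_ball empirical.
Proof.
move=> z1 f g f0 mf g0 mg fg; rewrite !integral_empirical//; congr (_ * _).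
by apply: eq_bigr => i _; exact: fg.
Qed.

Lemma integral_empirical_pair (f : X -> X -> R) :
  (forall x y, 0 <= f x y)%R -> measurable_fun setT (fun p : X * X => f p.1 p.2) ->
  \int[prodP empirical empirical]_p (f p.1 p.2)%:E =
  (N%:R^-1 ^+ 2 * \sum_(i < N) \sum_(j < N) f (z i) (z j))%:E.
Proof.
move=> f0 mf.
have mfE : measurable_fun setT (fun p : X * X => (f p.1 p.2)%:E) by apply/measurable_EFinP.
have f0E x y : 0 <= (f x y)%:E by rewrite lee_fin.
rewrite [LHS](integral_prodE empirical empirical (f := fun x y => (f x y)%:E) mfE f0E).
rewrite integral_empirical; first last.
- exact: (measurable_integral_param empirical mfE f0E).
- by move=> x; apply: integral_ge0.
rewrite (eq_bigr (fun i => (N%:R^-1 * \sum_(j < N) f (z i) (z j))%:E)) => [|i _].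
  by rewrite sumEFin -EFinM -mulr_sumr mulrA expr2.
rewrite integral_empirical//; first by rewrite sumEFin -EFinM.
exact: (measurableT_comp mfE (pair1_measurable (z i))).
Qed.

End empirical_measure.

(** * Identification with the given cap discrepancy *)

Section cap_discrepancy.
Context {R : realType} (d N : nat) (z : 'I_N -> 'rV[R]_d.+1).
Hypothesis N0 : (0 < N)%N.
Hypothesis zS : forall i, on_sphere (z i).
Local Notation X := (d.+1.-tuple R).
Local Open Scope ereal_scope.

Definition row_tuple (v : 'rV[R]_d.+1) : X := [tuple v ord0 i | i < d.+1].

Lemma rv_row_tuple v : rv (row_tuple v) = v.
Proof. by apply/rowP => i; rewrite mxE tnth_mktuple. Qed.

Lemma eucl_dist (v w : 'rV[R]_d.+1) : eucl (v - w)%R = dist (row_tuple v) (row_tuple w).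
Proof.
rewrite -[v in LHS]rv_row_tuple -[w in LHS]rv_row_tuple /dist -eucl_rv.
by congr eucl; apply/rowP => i; rewrite !mxE !tnth_mktuple.
Qed.

Lemma nsq_row_tuple i : nsq (row_tuple (z i)) = 1%R.
Proof.
have := zS i; rewrite /on_sphere -[z i in LHS]rv_row_tuple eucl_rv => h.
by rewrite -[LHS]sqr_sqrtr ?nsq_ge0// h expr1n.
Qed.

Let P := empirical (fun i => row_tuple (z i)) N0.

(** The points lie on the sphere, so membership in a cap is the half-space condition alone, and the
    counting average is the empirical [capP]. *)
Lemma cap_disc2E : cap_disc2 z = disc2 P.
Proof.
rewrite /cap_disc2 /disc2; apply: eq_integral => t _.
have mh x : measurable_fun setT (fun y : X => ((t <= tdot x y)%R%:R)%:E : \bar R).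
  by apply/measurable_EFinP; apply: measurable_halfspace; mm.
have h0 x (y : X) : 0 <= ((t <= tdot x y)%R%:R)%:E :> \bar R by rewrite lee_fin ler0n.
have E x : (((N%:R)^-1 * (\sum_(j < N) (\1_(cap (rv x) t) (z j) : R)) - cap_measure (rv x) t) ^+ 2)%:E =
    ((capP P x t - capP sphereP x t) ^+ 2)%:E :> \bar R.
  congr (_%:E); congr (_ ^+ 2)%R; congr (_ - _)%R.
    apply: EFin_inj; rewrite -capPE integral_empirical//.
    rewrite sumEFin -EFinM; congr (_ * _)%:E; apply: eq_bigr => j _.
    rewrite -dotv_rv rv_row_tuple indicE.
    have -> // : (z j \in cap (rv x) t) = (t <= dotv (rv x) (z j))%R.
    apply/idP/idP; first by rewrite inE /cap /= => -[].
    by move=> h; rewrite inE /cap /=; split => //; exact: zS.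
  rewrite /cap_measure sphere_intE.
  - by rewrite /capP; congr fine; apply: eq_integral => y _; rewrite dotv_rv.
  - by move=> v; rewrite lee_fin ler0n.
  - by rewrite /comp; under eq_fun do rewrite dotv_rv; exact: mh.
rewrite sphere_intE.
- by apply: eq_integral => x _; rewrite E.
- by move=> v; rewrite lee_fin sqr_ge0.
- have mid := @measurable_id _ X setT.
  have h (Q : probability X R) : measurable_fun setT (fun x : X => capP Q x t).
    by apply: measurable_capP; mm.
  have h1 := h P; have h2 := h sphereP.
  have mE : measurable_fun setT (fun x : X => ((capP P x t - capP sphereP x t) ^+ 2)%:E).
    by mm.
  rewrite (_ : _ \o _ = fun x : X => ((capP P x t - capP sphereP x t) ^+ 2)%:E); first exact: mE.
  by apply/funext => x /=; exact: E.
Qed.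

End cap_discrepancy.

(** * Comparison with the logarithmic kernel and choice of constants *)

Local Open Scope ring_scope.

(** With [s] the square root of [1 + t], one has [2 + t = 1 + s^2 <= (s + 1)^2] and
    [ln (1 + s) <= s]. *)
Lemma ln_le_sqrt (R : realType) (t : R) : 0 <= t -> ln (2 + t) <= 2 * Num.sqrt (1 + t).
Proof.
move=> t0; set s := Num.sqrt _.
have s1 : 1 <= s by rewrite -sqrtr1 ler_sqrt ?lerDl// addr_ge0.
have s2 : s ^+ 2 = 1 + t by rewrite sqr_sqrtr// addr_ge0.
have sp : 0 < s + 1 by lra.
apply: (@le_trans _ _ (ln ((s + 1) ^+ 2))).
  rewrite ler_ln ?posrE ?exprn_gt0//; last by lra.
  by rewrite sqrrD; nra.
have h : ln (s + 1) <= s by rewrite addrC; apply: le_ln1Dx; lra.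
by rewrite lnXn// mulr2n; lra.
Qed.

(** As [A >= 1], [1 + A m r <= A (1 + m r)], which extracts the power of [A]. The remaining half
    power of [1 + m r] pays for the logarithm. *)
Lemma kern_ge_log (R : realType) (d : nat) (A m r : R) : 1 <= A -> 0 <= m -> 0 <= r ->
  2^-1 * (Num.sqrt A)^-1 ^+ d.*2.+1 * (ln (2 + m * r) / (1 + m * r) ^+ d.+1) <=
  kern d (Num.sqrt (A * m)) r.
Proof.
move=> A1 m0 r0; have A0 : 0 < A by lra.
have mr0 : 0 <= m * r by rewrite mulr_ge0.
set s := Num.sqrt (1 + m * r).
have s2 : s ^+ 2 = 1 + m * r by rewrite sqr_sqrtr// addr_ge0.
have s0 : 0 < s by rewrite sqrtr_gt0 ltr_wpDr.
have sA0 : 0 < Num.sqrt A by rewrite sqrtr_gt0.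
rewrite -s2 -exprM mul2n doubleS.
apply: (@le_trans _ _ ((Num.sqrt A)^-1 ^+ d.*2.+1 * s^-1 ^+ d.*2.+1)).
  rewrite mulrAC mulrC; apply: ler_wpM2l; first by rewrite exprn_ge0// invr_ge0 ltW.
  rewrite mulrA ler_pdivrMr ?exprn_gt0//.
  have -> : s^-1 ^+ d.*2.+1 * s ^+ d.*2.+2 = s.
    by rewrite mulrC exprS -mulrA -exprMn mulfV ?gt_eqF// expr1n mulr1.
  by have := ln_le_sqrt mr0; rewrite -/s; lra.
rewrite /kern -exprMn -invfM.
have q0 : 0 < Num.sqrt (1 + Num.sqrt (A * m) ^+ 2 * r).
  by rewrite sqrtr_gt0 ltr_wpDr// mulr_ge0// sqr_ge0.
apply: lerXn2r; rewrite ?nnegrE ?invr_ge0 ?(ltW q0) ?mulr_ge0 ?(ltW s0) ?(ltW sA0)//.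
rewrite lef_pV2 ?posrE ?mulr_gt0// sqr_sqrtr ?mulr_ge0// ?(ltW A0)//.
rewrite -sqrtrM ?(ltW A0)// ler_sqrt; last by rewrite mulr_ge0 ?(ltW A0)// addr_ge0.
by rewrite mulrDr mulr1 mulrA lerD2r.
Qed.

Theorem theorem3 (R : realType) (d : nat) (hd : (1 <= d)%N) :
  exists c : R, 0 < c /\
    forall (N : nat) (z : 'I_N -> 'rV[R]_d.+1),
      (1 <= N)%N ->
      injective z ->
      (forall i, on_sphere (z i)) ->
      c * (N%:R `^ (- (2^-1) - (2 * d%:R)^-1))
        * Num.sqrt ((N%:R)^-1 *
            \sum_(i < N) \sum_(j < N)
              ln (2 + N%:R `^ (d%:R^-1) * eucl (z i - z j))
              / (1 + N%:R `^ (d%:R^-1) * eucl (z i - z j)) ^+ d.+1)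
      <= cap_disc z.
Proof.
have [c [C [c0 C0 HL]]] := @energy_lower R d hd.
(* Chosen so that [C / A^d <= c / 2], using [A^d >= A >= 2 C / c]; this is what absorbs the surface
   term in [lA]. *)
pose A : R := 1 + 2 * C / c.
have Ac0 : 0 < 2 * C / c by rewrite divr_gt0// mulr_gt0.
have A1 : 1 <= A by rewrite lerDl ltW.
have A0 : 0 < A by lra.
pose B : R := 2^-1 * (Num.sqrt A)^-1 ^+ d.*2.+1.
have B0 : 0 < B by rewrite mulr_gt0// exprn_gt0// invr_gt0 sqrtr_gt0.
(* After absorption [c / (2 A m)] times [K] is at most [C D], and [B] compares [K] with the
   logarithmic sum. The square root of [k] is taken because this bounds the squared discrepancy. *)
pose k : R := c * B / (2 * C * A).
have k0 : 0 < k by apply: divr_gt0; apply: mulr_gt0 => //; exact: mulr_gt0.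
exists (Num.sqrt k); split; first by rewrite sqrtr_gt0.
move=> N z N1 _ zS.
pose P := empirical (fun i => row_tuple (z i)) N1.
have HP : in_ball P by apply: in_ball_empirical => i; rewrite nsq_row_tuple.
have N0 : 0 < N%:R :> R by rewrite ltr0n.
set m := N%:R `^ d%:R^-1.
have m0 : 0 < m by rewrite powR_gt0.
have md : m ^+ d = N%:R.
  by rewrite -powR_mulrn ?powR_ge0// /m -powRrM mulVf ?pnatr_eq0 -?lt0n// powRr1 ?ler0n.
pose l := Num.sqrt (A * m).
have Am0 : 0 < A * m by rewrite mulr_gt0.
have l0 : 0 < l by rewrite sqrtr_gt0.
have l2 : l ^+ 2 = A * m by rewrite sqr_sqrtr// ltW.
have l2V : l^-1 ^+ 2 = (A * m)^-1 by rewrite exprVn l2.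
pose T i j : R := ln (2 + m * eucl (z i - z j)) / (1 + m * eucl (z i - z j)) ^+ d.+1.
pose D := fine (disc2 P).
have DE : disc2 P = D%:E by rewrite fineK// disc2_fin.
pose S := \sum_(i < N) \sum_(j < N) T i j.
pose rt i := row_tuple (z i).
pose K := N%:R^-1 ^+ 2 * \sum_(i < N) \sum_(j < N) kern d l (dist (rt i) (rt j)).
have HK : c * (A * m)^-1 * K <= C * D + C * l^-1 ^+ d.*2.+2.
  have := HL P HP l l0.
  rewrite (integral_empirical_pair _ N1 (fun x y => kern_ge0 d l (dist x y))); last first.
    by apply: measurable_kern; exact: measurable_dist.
  by rewrite DE -!EFinM -EFinD lee_fin l2V.
(* The [N] diagonal terms are each equal to 1 and the others are nonnegative. *)
have K1 : N%:R^-1 <= K.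
  rewrite /K expr2 -mulrA ler_peMr ?invr_ge0 ?ler0n//.
  rewrite ler_pdivlMl// mulr1.
  rewrite -[leLHS]mulr1 mulr_natl -[X in _ *+ X]card_ord -sumr_const.
  apply: ler_sum => i _; rewrite (bigD1 i)//=.
  have -> : dist (rt i) (rt i) = 0.
    rewrite /dist; have -> : nsq (sub (rt i) (rt i)) = 0; last by rewrite sqrtr0.
    by rewrite nsqB -/(nsq _); ring.
  rewrite {1}/kern mulr0 addr0 sqrtr1 invr1 expr1n lerDl.
  by apply: sumr_ge0 => j _; exact: kern_ge0.
(* Since [m^d = N], [l^(-2d - 2) = A^-d N^-1 (A m)^-1], and [K1] bounds [N^-1] by [K]. *)
have lA : C * l^-1 ^+ d.*2.+2 <= 2^-1 * (c * (A * m)^-1 * K).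
  have AN : A <= A ^+ d by rewrite -[leLHS]expr1 ler_weXn2l.
  rewrite -addn2 exprD l2V -mul2n exprM l2V.
  have -> : (A * m)^-1 ^+ d = (A ^+ d)^-1 * N%:R^-1 by rewrite exprVn exprMn md invfM.
  have h : C * (A ^+ d)^-1 <= 2^-1 * c.
    rewrite ler_pdivrMr ?exprn_gt0//; apply: (@le_trans _ _ (2^-1 * c * A)).
      have -> : 2^-1 * c * A = 2^-1 * c + C by rewrite /A; field; rewrite gt_eqF.
      by rewrite lerDr mulr_ge0// ltW.
    by rewrite ler_wpM2l// mulr_ge0// ltW.
  have i0 : 0 <= (A * m)^-1 by rewrite invr_ge0 ltW.
  have Ni0 : 0 <= N%:R^-1 :> R by rewrite invr_ge0 ler0n.
  have h1 := ler_wpM2r Ni0 h.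
  have c20 : 0 <= 2^-1 * c by rewrite mulr_ge0// ltW.
  have h2 := ler_wpM2l c20 K1.
  have h3 := ler_wpM2r i0 (le_trans h1 h2).
  have -> : C * ((A ^+ d)^-1 * N%:R^-1 * (A * m)^-1) = C * (A ^+ d)^-1 * N%:R^-1 * (A * m)^-1 by ring.
  by apply: (le_trans h3); rewrite le_eqVlt; apply/orP; left; apply/eqP; ring.
have KS : B * (N%:R^-1 ^+ 2 * S) <= K.
  rewrite mulrCA /K; apply: ler_wpM2l; first by rewrite exprn_ge0// invr_ge0 ler0n.
  rewrite /S mulr_sumr; apply: ler_sum => i _; rewrite mulr_sumr; apply: ler_sum => j _.
  rewrite /T eucl_dist; apply: kern_ge_log => //; first exact: ltW.
  exact: dist_ge0.
have DS : k * (N%:R^-1 * m^-1 * (N%:R^-1 * S)) <= D.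
  have h1 : 2^-1 * (c * (A * m)^-1 * K) <= C * D by lra.
  have h2 : 2^-1 * (c * (A * m)^-1) * (B * (N%:R^-1 ^+ 2 * S)) <= C * D.
    apply: le_trans h1; rewrite [leRHS]mulrA; apply: ler_wpM2l => //.
    by rewrite !mulr_ge0 ?invr_ge0// ltW.
  rewrite -(ler_pM2l C0); apply: le_trans h2.
  rewrite le_eqVlt; apply/orP; left; apply/eqP; rewrite /k; field.
  by rewrite !gt_eqF.
(* Squaring doubles the exponent to [-1 - 1/d], that is, to [(N m)^-1]. *)
have mN : N%:R `^ (- (2^-1) - (2 * d%:R)^-1) = Num.sqrt (N%:R^-1 * m^-1).
  have d0 : d%:R != 0 :> R by rewrite pnatr_eq0 -lt0n.
  rewrite -[LHS]ger0_norm ?powR_ge0// -sqrtr_sqr; congr Num.sqrt.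
  rewrite expr2 -powRD; last by apply/implyP => _; rewrite gt_eqF.
  have -> : - 2^-1 - (2 * d%:R)^-1 + (- 2^-1 - (2 * d%:R)^-1) = - 1 + - d%:R^-1 :> R.
    by field.
  rewrite powRD; last by apply/implyP => _; rewrite gt_eqF.
  by rewrite powR_inv1 ?ler0n// powRN.
have nn : 0 <= N%:R^-1 * m^-1 by rewrite mulr_ge0 ?invr_ge0 ?ler0n// ltW.
rewrite mN /cap_disc (cap_disc2E N1 zS) -/P -/D -/S -!sqrtrM//; last first.
- by rewrite ltW.
- by rewrite mulr_ge0// ltW.
have D0 : 0 <= D.
  apply: fine_ge0; apply: integral_ge0 => t _.
  by apply: integral_ge0 => x _; rewrite lee_fin sqr_ge0.
by rewrite ler_sqrt// -mulrA.
Qed.
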